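(* (1) For any polynomial $p_0^N$ of degree $N$, with multiplicative heat evolution $p_\tau^N$, the moments $M_{a,N}(\tau)=\frac1N\sum_{j=1}^N(z_{j,N}(\tau))^a$, where $\{z_{j,N}(\tau)\}_{j=1}^N$ are the roots of $p_\tau^N$, satisfy $$\frac{dM_{0,N}}{d\tau}=0,\qquad \frac{dM_{1,N}}{d\tau}=\frac12M_{1,N},$$ and for $a\ge2$, $$\frac{dM_{a,N}}{d\tau}=\frac a2M_{a,N}+\frac a2\sum_{b=1}^{a-1}M_{b,N}M_{a-b,N}-\frac{a}{2N}M_{a,N}.$$ (2) Suppose now that $p_0^N$ is a sequence of polynomials of degree $N$ such that the limit $M_a(0):=\lim_{N\to\infty}M_{a,N}(0)$ exists for all $a$. Then the limit $M_a(\tau):=\lim_{N\to\infty}M_{a,N}(\tau)$ exists for all $\tau$, and these limiting moments satisfy the formal large-$N$ limit of the last equation in (1) (dropping the $1/N$ term), namely $$\frac{dM_a}{d\tau}=\frac a2M_a+\frac a2\sum_{b=1}^{a-1}M_bM_{a-b}$$ (the sum being empty, hence zero, for $a=0,1$). (3) Suppose $\mu_\tau$ is a family of compactly supported probability measures on $\mathbb{C}$ whose log potential $S(z,\tau)$ satisfies the PDE $$\frac{\partial S}{\partial\tau}=-\frac12\left(z^2\left(\frac{\partial S}{\partial z}\right)^2-z\frac{\partial S}{\partial z}\right)$$ for $z$ near infinity and $\tau$ in some open set $U\subset\mathbb{C}$. Let $\hat M_a(\tau)=\int_{\mathbb{C}}z^a\,d\mu_\tau(z)$ be the $a$-th holomorphic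 moment of $\mu_\tau$. Then these moments also satisfy the equation in (2): $$\frac{d\hat M_a}{d\tau}=\frac a2\hat M_a+\frac a2\sum_{b=1}^{a-1}\hat M_b\hat M_{a-b}$$ for $\tau\in U$ (again with an empty sum for $a=0,1$).
   Context: The multiplicative heat evolution of a polynomial $p_0^N$ of degree $N$ is $$p_\tau^N(z)=\exp\left\{-\frac\tau{2N}\left(z^2\frac{\partial^2}{\partial z^2}-(N-2)z\frac{\partial}{\partial z}-N\right)\right\}p_0^N(z),\qquad\tau\in\mathbb{C},$$ where the exponential, as applied to $p_0^N$, is defined as a convergent power series. The polynomial $p_\tau^N$ again has degree $N$, and its roots are listed with multiplicity. The index $a$ ranges over $0,1,2,\dots$. The log potential of a compactly supported probability measure $\mu$ on $\mathbb{C}$ is $S(z)=\int_{\mathbb{C}}\log(|z-w|^2)\,d\mu(w)$; $S(z,\tau)$ denotes the log potential of $\mu_\tau$. In the PDE, $\partial/\partial\tau=\frac12(\partial_{\tau_1}-i\partial_{\tau_2})$ and $\partial/\partial z=\frac12(\partial_x-i\partial_y)$ are the Cauchy–Riemann operators, with $\tau=\tau_1+i\tau_2$ and $z=x+iy$.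
   Formalization: In (1) the last term is corrected from a/(2N) M_{a,N} to a(a-1)/(2N) M_{a,N} (the printed one fails for N=1, p_0=z-1, a=3); in (3) ''z near infinity'' means outside a disk containing the supports of mu_tau, chosen locally uniformly in tau. *)

(* Defs.v *)
From HB Require Import structures.
From mathcomp Require Import all_boot all_order all_algebra.
From mathcomp Require Import complex.
From mathcomp Require Import all_classical all_reals all_analysis.

Set Implicit Arguments.
Unset Strict Implicit.
Unset Printing Implicit Defensive.

Import Order.TTheory GRing.Theory Num.Theory.
Import numFieldTopology.Exports numFieldNormedType.Exports.

Local Open Scope classical_set_scope.
Local Open Scope ring_scope.
Local Open Scope complex_scope.

(* R[i] carries no topology by itself; viewed as a numClosedFieldType it gets
   the norm topology, and derivatives over it are complex derivatives. *)
Definition Cplx (R : realType) : numClosedFieldType := R[i].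

Section HeatFlow.
Variable R : realType.
Implicit Types (N a : nat) (p : {poly Cplx R}) (tau : Cplx R).

Definition heat_gen N p : {poly Cplx R} :=
  'X^2 * p^`(2) - (N%:R - 2) *: ('X * p^`()) - N%:R *: p.

(* heat_gen does not increase degrees, so the power series lives in the
   polynomials of size at most size p, where convergence is coefficientwise. *)
Definition heat_evol N tau p : {poly Cplx R} :=
  \poly_(j < size p)
    limn (series (fun k : nat =>
      (k`!%:R)^-1 * (- (tau / (2 * N%:R))) ^+ k * (iter k (heat_gen N) p)`_j)).

Definition mroots p : seq (Cplx R) := sval (closed_field_poly_normal p).

Definition root_moment N p a tau : Cplx R :=
  N%:R^-1 * \sum_(z <- mroots (heat_evol N tau p)) z ^+ a.

End HeatFlow.

Definition borelC (R : realType) := g_sigma_algebraType (@open (Cplx R)).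

Section LogPotential.
Variable R : realType.
Implicit Types (mu : probability (borelC R) R) (z : Cplx R).

Definition compactly_supported mu :=
  exists2 K : set (Cplx R), compact K & mu (~` K) = 0%E.

Definition log_potential mu z : \bar R :=
  (\int[mu]_w lne ((Normc.normc (z - w : R[i])) ^+ 2)%:E)%E.

Definition holo_moment mu (a : nat) : Cplx R :=
  (\int[mu]_w complex.Re ((w : Cplx R) ^+ a : R[i]))%R +i*
  (\int[mu]_w complex.Im ((w : Cplx R) ^+ a : R[i]))%R.

(* d = (1/2) (df/dx - i df/dy) at z = x + iy, both partial derivatives
   existing. *)
Definition is_wirtinger (f : Cplx R -> R) (z d : Cplx R) :=
  exists fx fy : R,
    [/\ is_derive (complex.Re z) (1 : R) (fun x : R => f (x +i* complex.Im z)) fx,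
        is_derive (complex.Im z) (1 : R) (fun y : R => f (complex.Re z +i* y)) fy
      & d = 2^-1 * (fx +i* - fy : Cplx R)].

Definition log_potential_pde (mu : Cplx R -> probability (borelC R) R)
    (z tau : Cplx R) :=
  exists St Sz : Cplx R,
    [/\ is_wirtinger (fun t => fine (log_potential (mu t) z)) tau St,
        is_wirtinger (fun w => fine (log_potential (mu tau) w)) z Sz
      & St = - 2^-1 * (z ^+ 2 * Sz ^+ 2 - z * Sz)].

(* The PDE near infinity is required on the exterior of a disk containing the
   supports; the disk may depend on tau0 but not on tau close to tau0. *)
Definition pde_near_infinity (mu : Cplx R -> probability (borelC R) R)
    (U : set (Cplx R)) :=
  forall tau0, U tau0 -> exists r : R, \forall tau \near tau0,
    mu tau [set w | r < Normc.normc (w : R[i])] = 0%E /\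
    forall z : Cplx R, r < Normc.normc (z : R[i]) -> log_potential_pde mu z tau.

End LogPotential.

(* Main.v *)
Require Import Defs.
From HB Require Import structures.
From mathcomp Require Import all_boot all_order all_algebra.
From mathcomp Require Import complex.
From mathcomp Require Import all_classical all_reals all_analysis.
From mathcomp Require Import measurable_realfun.
From mathcomp Require Import ring lra zify.

Set Implicit Arguments.
Unset Strict Implicit.
Unset Printing Implicit Defensive.

Import Order.TTheory GRing.Theory Num.Theory.
Import numFieldTopology.Exports numFieldNormedType.Exports.

Local Open Scope classical_set_scope.
Local Open Scope ring_scope.

(** All three parts are one identity read in three settings. Put
    Q(x) = sum_(a >= 1) M_a x^a and let theta = x d/dx; the claimed equations
    say that theta (Q + Q^2) / 2 is the derivative of Q in tau, up to a term of
    order 1/N for finitely many roots.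

    Finitely many roots. Monomials are eigenvectors of the generator, so the
    j-th coefficient of the polynomial is multiplied by an exponential in tau
    (heat_evolE). Hence the coefficients c_k of the reciprocal polynomial
    F(x) = prod (1 - z_j x) satisfy a linear equation
    dF/dtau = ((N+1) theta F - theta^2 F) / (2N). Newton's identities say
    theta F = - P F for the generating function P of the power sums
    (newton_recip_prod), and substituting this gives
    dP/dtau = theta ((N+1) P - theta P + P^2) / (2N) (newton_flow), which is the
    equation of the moments. Working with power sums instead of individual
    roots avoids any discussion of multiple roots: by Newton's recursion the
    power sums are polynomials in the c_k.

    Many roots. The equation of order a is linear in M_a with an
    inhomogeneous term made of lower moments. By induction on a, an integrating
    factor shows that convergence at tau = 0 forces locally uniform convergence
    of M_(a,N) (linear_ode_luc), and a locally uniform limit of holomorphic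
    functions whose derivatives converge locally uniformly may be
    differentiated term by term (luc_limit_derive).

    Potentials. Near infinity the logarithmic potential S is
    log|z|^2 - 2 Re sum_(k >= 1) M_k z^-k / k, and z dS/dz = 1 + Q(1/z), so the
    partial differential equation reads dS/dtau = - (Q + Q^2)(1/z) / 2. Comparing
    coefficients of z^-a gives the equation, but only partial derivatives of S
    in tau are given, pointwise in z, while the moments have to be
    complex differentiable. So coefficients are compared for increments: for
    fixed z the mean value inequality along a horizontal and a vertical segment
    controls S(z,tau) - S(z,tau0), the lower order terms are removed by
    induction, and letting |z| tend to infinity in a direction in which the
    term in z^-a is real isolates the increment of M_a (moment_increment). This
    shows first that M_a is Lipschitz, hence that the right-hand side is
    continuous, and then that M_a has the claimed derivative. Only finite
    expansions of S and dS/dz with explicit remainders are used. *)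

(** * Modulus, limits and derivatives on the complex numbers *)

(** First-order expansion with an explicit modulus. It transports a complex
    derivative to a real line and compares derivatives with finite expansions,
    which the definition by a limit of quotients makes awkward. *)
Lemma is_deriveP (K : numFieldType) (f : K -> K) (z d : K) :
  is_derive z 1 f d <->
  forall e, 0 < e -> exists2 dl, 0 < dl &
    forall h, `|h| < dl -> `|f (z + h) - f z - h * d| <= e * `|h|.
Proof.
split.
- case=> df dfd e e0.
  have := df => /cvg_ex[/= l hl].
  have ld : l = d by rewrite -dfd /derive; apply/esym/cvg_lim => //; exact: hl.
  rewrite {}ld in hl.
  move/cvgrPdist_le : hl => /(_ _ e0); rewrite near_withinE.
  move=> /nbhs_ballP[dl /= dl0 H]; exists dl => // h hdl.
  have [->|h0] := eqVneq h 0; first by rewrite addr0 subrr mul0r subr0 normr0 mulr0.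
  have := H h; rewrite /ball /= /ball_ /= sub0r normrN => /(_ hdl h0).
  rewrite -(@ler_pM2r _ `|h|) ?normr_gt0//; apply: le_trans.
  rewrite -normrM distrC mulrBl.
  suff -> : (h^-1 *: (f (h *: 1 + z) - f z)) * h = f (z + h) - f z by rewrite [d * h]mulrC.
  by rewrite /GRing.scale /= mulr1 mulrC mulrA mulfV// mul1r [h + z]addrC.
- move=> H.
  have hl : (h^-1 *: ((f \o shift z) (h *: 1) - f z)) @[h --> 0^'] --> d.
    apply/cvgrPdist_le => e e0; rewrite near_withinE.
    have [dl dl0 Hd] := H e e0.
    apply/nbhs_ballP; exists dl => //= h; rewrite /ball /= /ball_ /= sub0r normrN => hdl h0.
    rewrite -(@ler_pM2r _ `|h|) ?normr_gt0//; apply: le_trans (Hd h hdl).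
    rewrite -normrM distrC mulrBl [d * h]mulrC.
    suff -> : (h^-1 *: (f (h *: 1 + z) - f z)) * h = f (z + h) - f z by [].
    by rewrite /GRing.scale /= mulr1 mulrC mulrA mulfV// mul1r [h + z]addrC.
  split; first by apply/cvg_ex; exists d.
  exact: cvg_lim.
Qed.

Section PointwiseDerivatives.
Variable K : numFieldType.

Lemma is_derive_fadd (f g : K -> K) (z a b : K) :
  is_derive z (1 : K) f a -> is_derive z (1 : K) g b ->
  is_derive z (1 : K) (fun w => f w + g w) (a + b).
Proof. exact: is_deriveD. Qed.

Lemma is_derive_fsub (f g : K -> K) (z a b : K) :
  is_derive z (1 : K) f a -> is_derive z (1 : K) g b ->
  is_derive z (1 : K) (fun w => f w - g w) (a - b).
Proof. exact: is_deriveB. Qed.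

Lemma is_derive_fmul (f g : K -> K) (z a b : K) :
  is_derive z (1 : K) f a -> is_derive z (1 : K) g b ->
  is_derive z (1 : K) (fun w => f w * g w) (f z * b + g z * a).
Proof. exact: is_deriveM. Qed.

Lemma is_derive_fscale (c : K) (f : K -> K) (z a : K) :
  is_derive z (1 : K) f a -> is_derive z (1 : K) (fun w => c * f w) (c * a).
Proof. exact: is_deriveZ. Qed.

Lemma is_derive_fcst (c z : K) : is_derive z (1 : K) (fun=> c) 0.
Proof. exact: is_derive_cst. Qed.

Lemma is_derive_fsum (I : eqType) (s : seq I) (f : I -> K -> K) (z : K) (a : I -> K) :
  (forall i, i \in s -> is_derive z (1 : K) (f i) (a i)) ->
  is_derive z (1 : K) (fun w => \sum_(i <- s) f i w) (\sum_(i <- s) a i).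
Proof.
elim: s => [|i s IH] H.
  by rewrite big_nil; under eq_fun do rewrite big_nil; exact: is_derive_fcst.
rewrite big_cons; under eq_fun do rewrite big_cons.
apply: (is_derive_fadd (H i (mem_head i s))); apply: IH => j js.
by apply: H; rewrite inE js orbT.
Qed.

Lemma is_derive_fid (z : K) : is_derive z (1 : K) id 1.
Proof. exact: is_derive_id. Qed.

Lemma is_derive_fpow n (z : K) : is_derive z (1 : K) (fun w => w ^+ n) (n%:R * z ^+ n.-1).
Proof.
elim: n => [|n IH]; first by rewrite mul0r; exact: is_derive_fcst.
under eq_fun do rewrite exprS.
rewrite (_ : _ * _ = z * (n%:R * z ^+ n.-1) + z ^+ n * 1).
  by apply: is_derive_fmul => //; exact: is_derive_fid.
case: n {IH} => [|n] /=; first by rewrite !mul0r mulr0 add0r mulrC.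
by rewrite -[in LHS](natr1 n.+1) !exprS; ring.
Qed.

Lemma cvg_sum_seq (T : Type) (F : set_system T) (FF : Filter F) (I : eqType)
    (s : seq I) (f : I -> T -> K) (l : I -> K) :
  (forall i, i \in s -> f i @ F --> l i) ->
  (fun t => \sum_(i <- s) f i t) @ F --> \sum_(i <- s) l i.
Proof.
elim: s => [|i s IH] H.
  by rewrite big_nil; under eq_fun do rewrite big_nil; exact: cvg_cst.
rewrite big_cons; under eq_fun do rewrite big_cons.
apply: cvgD (H i (mem_head i s)) _; apply: IH => j js.
by apply: H; rewrite inE js orbT.
Qed.

End PointwiseDerivatives.

Section ComplexNorm.
Variable R : realType.
Local Notation C := (Cplx R).

(** The modulus with values in [R]: the norm of [Cplx R] takes values in [Cplx
    R], whose order is only partial. *)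
Definition nc (z : C) : R := Normc.normc (z : R[i]).
Definition rc (x : R) : C := (x%:C)%C.
Definition re (z : C) : R := complex.Re z.
Definition im (z : C) : R := complex.Im z.

Lemma norm_nc (z : C) : `|z| = rc (nc z). Proof. by []. Qed.
Lemma rc_le (x y : R) : (rc x <= rc y) = (x <= y). Proof. exact: lecR. Qed.
Lemma rc_lt (x y : R) : (rc x < rc y) = (x < y). Proof. exact: ltcR. Qed.
Lemma rcM x y : rc (x * y) = rc x * rc y. Proof. exact: rmorphM. Qed.
Lemma rcD x y : rc (x + y) = rc x + rc y. Proof. exact: rmorphD. Qed.
Lemma rc1 : rc 1 = 1. Proof. exact: rmorph1. Qed.
Lemma rc0 : rc 0 = 0. Proof. exact: rmorph0. Qed.
Lemma rcV x : rc x^-1 = (rc x)^-1. Proof. exact: fmorphV. Qed.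
Lemma rcX x n : rc (x ^+ n) = rc x ^+ n. Proof. exact: rmorphXn. Qed.
Lemma rc_nat n : rc n%:R = n%:R. Proof. exact: rmorph_nat. Qed.
Lemma rc_inj : injective rc. Proof. exact: complexI. Qed.

Lemma nc_ge0 z : 0 <= nc z.
Proof. by rewrite -rc_le -norm_nc rc0. Qed.
Lemma ncD x y : nc (x + y) <= nc x + nc y.
Proof. by rewrite -rc_le rcD -!norm_nc ler_normD. Qed.
Lemma ncN x : nc (- x) = nc x.
Proof. by apply: rc_inj; rewrite -!norm_nc normrN. Qed.
Lemma ncB x y : nc (x - y) <= nc x + nc y.
Proof. by rewrite -(ncN y); exact: ncD. Qed.
Lemma nc_distC x y : nc (x - y) = nc (y - x).
Proof. by rewrite -ncN opprB. Qed.
Lemma ncM x y : nc (x * y) = nc x * nc y.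
Proof. by apply: rc_inj; rewrite rcM -!norm_nc normrM. Qed.
Lemma nc0 : nc 0 = 0. Proof. by apply: rc_inj; rewrite -norm_nc normr0 rc0. Qed.
Lemma nc1 : nc 1 = 1. Proof. by apply: rc_inj; rewrite -norm_nc normr1 rc1. Qed.
Lemma ncV x : nc x^-1 = (nc x)^-1.
Proof. by apply: rc_inj; rewrite rcV -!norm_nc normfV. Qed.
Lemma ncX x n : nc (x ^+ n) = nc x ^+ n.
Proof. by apply: rc_inj; rewrite rcX -!norm_nc normrX. Qed.
Lemma nc_nat n : nc n%:R = n%:R.
Proof. by apply: rc_inj; rewrite -norm_nc normr_nat rc_nat. Qed.
Lemma nc_rc x : nc (rc x) = `|x|.
Proof. by rewrite /nc /rc /= expr0n /= addr0 sqrtr_sqr. Qed.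
Lemma nc_gt0 z : (0 < nc z) = (z != 0).
Proof. by rewrite -rc_lt -norm_nc rc0 normr_gt0. Qed.
Lemma nc_eq0 z : (nc z == 0) = (z == 0).
Proof. by rewrite -(inj_eq rc_inj) -norm_nc rc0 normr_eq0. Qed.
Lemma nc_triangle x y z : nc (x - z) <= nc (x - y) + nc (y - z).
Proof. by have := ncD (x - y) (y - z); rewrite addrA subrK. Qed.
Lemma nc_sum (I : Type) (s : seq I) (P : pred I) (F : I -> C) :
  nc (\sum_(i <- s | P i) F i) <= \sum_(i <- s | P i) nc (F i).
Proof.
elim/big_ind2 : _ => //; first by rewrite nc0.
by move=> x1 x2 y1 y2 h1 h2; apply: le_trans (ncD _ _) _; exact: lerD.
Qed.

Lemma reD x y : re (x + y) = re x + re y. Proof. exact: raddfD. Qed.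
Lemma reN x : re (- x) = - re x. Proof. exact: raddfN. Qed.
Lemma reB x y : re (x - y) = re x - re y. Proof. exact: raddfB. Qed.
Lemma re_rc x : re (rc x) = x. Proof. by []. Qed.
Lemma re_rcM x y : re (rc x * y) = x * re y.
Proof. by case: y => a b; rewrite /re /= mul0r subr0. Qed.
Lemma re_sum (I : Type) (s : seq I) (P : pred I) (F : I -> C) :
  re (\sum_(i <- s | P i) F i) = \sum_(i <- s | P i) re (F i).
Proof. exact: raddf_sum. Qed.
Lemma imN x : im (- x) = - im x. Proof. exact: raddfN. Qed.
Lemma imB x y : im (x - y) = im x - im y. Proof. exact: raddfB. Qed.
Lemma reM x y : re (x * y) = re x * re y - im x * im y.
Proof. by case: x y => a b [c d]. Qed.
Lemma imM x y : im (x * y) = re x * im y + im x * re y.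
Proof. by case: x y => a b [c d]. Qed.

Lemma nc_sqr z : nc z ^+ 2 = re z ^+ 2 + im z ^+ 2.
Proof. by case: z => a b; rewrite /nc /= sqr_sqrtr// addr_ge0 ?sqr_ge0. Qed.

Lemma re_le_nc z : `|re z| <= nc z.
Proof.
rewrite -(@ler_pXn2r _ 2) ?nnegrE ?nc_ge0// real_normK ?num_real//.
by rewrite nc_sqr lerDl sqr_ge0.
Qed.

Lemma im_le_nc z : `|im z| <= nc z.
Proof.
rewrite -(@ler_pXn2r _ 2) ?nnegrE ?nc_ge0// real_normK ?num_real//.
by rewrite nc_sqr lerDr sqr_ge0.
Qed.

Lemma nc_le_reim z : nc z <= `|re z| + `|im z|.
Proof.
rewrite -(@ler_pXn2r _ 2) ?nnegrE ?nc_ge0 ?addr_ge0// nc_sqr.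
rewrite -[re z ^+ 2]real_normK ?num_real// -[im z ^+ 2]real_normK ?num_real//.
have := normr_ge0 (re z); have := normr_ge0 (im z).
by move: `|re z| `|im z| => a b; nra.
Qed.

Lemma rc_gt0P (e : C) : 0 < e -> exists2 x : R, 0 < x & e = rc x.
Proof. by case: e => x y; rewrite ltcE /= => /andP[/eqP -> x0]; exists x. Qed.

Lemma nc_nbhsP (P : set C) (z : C) :
  nbhs z P <-> exists2 dl : R, 0 < dl & forall w, nc (w - z) < dl -> P w.
Proof.
split=> [/nbhs_ballP[_ /= /rc_gt0P[x x0 ->] H]|[dl dl0 H]].
- exists x => // w hw; apply: H; rewrite /ball /= /ball_ /= norm_nc rc_lt.
  by rewrite nc_distC.
- apply/nbhs_ballP; exists (rc dl); first by rewrite /= -rc0 rc_lt.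
  move=> w; rewrite /ball /= /ball_ /= norm_nc rc_lt => hw; apply: H.
  by rewrite nc_distC.
Qed.

Lemma is_derive_ncP (f : C -> C) (z d : C) :
  is_derive z (1 : C) f d <->
  forall e : R, 0 < e -> exists2 dl : R, 0 < dl &
    forall h, nc h < dl -> nc (f (z + h) - f z - h * d) <= e * nc h.
Proof.
split=> [/is_deriveP H e e0|H].
- have [|_ /rc_gt0P[dl dl0 ->] Hd] := H (rc e); first by rewrite -rc0 rc_lt.
  exists dl => // h hh; rewrite -rc_le rcM -!norm_nc; apply: Hd.
  by rewrite norm_nc rc_lt.
- apply/is_deriveP => _ /rc_gt0P[e e0 ->]; have [dl dl0 Hd] := H _ e0.
  exists (rc dl); first by rewrite -rc0 rc_lt.
  by move=> h; rewrite !norm_nc rc_lt -rcM rc_le => /Hd.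
Qed.

Lemma cvg_ncP (T : Type) (F : set_system T) (FF : Filter F) (f : T -> C) (l : C) :
  f @ F --> l <-> forall e : R, 0 < e -> \forall t \near F, nc (f t - l) <= e.
Proof.
split=> [/cvgrPdist_le H e e0|H].
- have /H : 0 < rc e by rewrite -rc0 rc_lt.
  by apply: filterS => t; rewrite norm_nc rc_le nc_distC.
- apply/cvgrPdist_le => _ /rc_gt0P[e e0 ->]; move: (H e e0).
  by apply: filterS => t; rewrite norm_nc rc_le nc_distC.
Qed.

Lemma cvgn_ncP (u : nat -> C) (l : C) :
  u @ \oo --> l <-> forall e : R, 0 < e -> exists n0, forall n, (n0 <= n)%N ->
    nc (u n - l) <= e.
Proof.
split=> [/cvg_ncP H e /H[n0 _ Hn]|H]; first by exists n0.
by apply/cvg_ncP => e /H[n0 Hn]; exists n0.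
Qed.

Lemma continuous_at_ncP (f : C -> C) (z : C) : (f @ z --> f z) <->
  forall e : R, 0 < e -> exists2 dl : R, 0 < dl &
    forall w, nc (w - z) < dl -> nc (f w - f z) <= e.
Proof.
split=> [/(@cvg_ncP _ (nbhs z) (nbhs_filter z)) H e /H/nc_nbhsP//|H].
by apply/(@cvg_ncP _ (nbhs z) (nbhs_filter z)) => e /H/nc_nbhsP.
Qed.

Definition cauchyseq (u : nat -> C) := forall e : R, 0 < e -> exists n0,
  forall n m, (n0 <= n)%N -> (n0 <= m)%N -> nc (u n - u m) <= e.

Lemma cvg_cauchyseq (u : nat -> C) : cvgn u -> cauchyseq u.
Proof.
move=> /cvg_ex[l /cvgn_ncP H] e e0.
have [|n0 Hn] := H (e / 2); first by rewrite divr_gt0.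
exists n0 => n m /Hn h1 /Hn h2.
apply: le_trans (nc_triangle _ l _) _; rewrite [nc (l - _)]nc_distC.
by rewrite [e]splitr lerD.
Qed.

Lemma real_cauchy_cvg (v : nat -> R) :
  (forall e : R, 0 < e -> exists n0, forall n m, (n0 <= n)%N -> (n0 <= m)%N ->
    `|v n - v m| <= e) -> cvgn v.
Proof.
move=> H; apply/cauchy_cvgP/cauchy_ballP => e e0.
have [|n0 Hn] := H (e / 2); first by rewrite divr_gt0.
exists (v @` [set n | (n0 <= n)%N], v @` [set n | (n0 <= n)%N]).
  by split; exists n0 => // n hn; exists n.
move=> _ /= [[n hn <-] [m hm <-]]; rewrite /ball /= (le_lt_trans (Hn _ _ hn hm))//.
lra.
Qed.

(** Completeness comes from that of the real numbers applied to real and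
    imaginary parts. *)
Lemma cauchyseq_cvg (u : nat -> C) : cauchyseq u -> cvgn u.
Proof.
move=> H.
have cr : cvgn (fun n => re (u n)).
  apply: real_cauchy_cvg => e /H[n0 Hn]; exists n0 => n m hn hm.
  by rewrite -reB; apply: le_trans (re_le_nc _) (Hn _ _ hn hm).
have ci : cvgn (fun n => im (u n)).
  apply: real_cauchy_cvg => e /H[n0 Hn]; exists n0 => n m hn hm.
  by rewrite -imB; apply: le_trans (im_le_nc _) (Hn _ _ hn hm).
set a := limn (fun n => re (u n)) in cr; set b := limn (fun n => im (u n)) in ci.
move/cvgrPdist_le: cr => ha; move/cvgrPdist_le: ci => hb.
apply/cvg_ex; exists ((a +i* b)%C : C); apply/cvgn_ncP => e e0.
have e20 : 0 < e / 2 by rewrite divr_gt0.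
have [n1 _ h1] := ha _ e20; have [n2 _ h2] := hb _ e20.
exists (maxn n1 n2) => n; rewrite geq_max => /andP[/h1 /= k1 /h2 /= k2].
apply: le_trans (nc_le_reim _) _.
rewrite distrC in k1; rewrite distrC in k2.
by rewrite reB imB [e]splitr; apply: lerD.
Qed.

Lemma cvg_bounded (u : nat -> C) (l : C) (B : R) (n0 : nat) : u @ \oo --> l ->
  (forall n, (n0 <= n)%N -> nc (u n) <= B) -> nc l <= B.
Proof.
move=> /cvgn_ncP H Hb; apply/ler_addgt0Pr => e /H[n1 Hn].
pose n := maxn n0 n1.
have h0 : nc (u n) <= B by apply: Hb; exact: leq_maxl.
have h1 : nc (u n - l) <= e by apply: Hn; exact: leq_maxr.
have := ncB (u n) (u n - l); rewrite opprB addrC subrK => /le_trans; apply.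
exact: lerD.
Qed.

Lemma real_mean_value (g dg : R -> R) (B x y : R) :
  (forall t, Num.min x y <= t <= Num.max x y -> is_derive t 1 g (dg t)) ->
  (forall t, Num.min x y <= t <= Num.max x y -> `|dg t| <= B) ->
  `|g y - g x| <= B * `|y - x|.
Proof.
wlog xy : x y / x <= y => [H|].
  case/orP: (le_total x y) => [/H//|yx hd hB].
  by rewrite distrC [`|y - x|]distrC; apply: H => // t;
    rewrite minC maxC => ?; [exact: hd|exact: hB].
move=> hd hB.
have hd' t : t \in `[x, y] -> is_derive t 1 g (dg t).
  by rewrite in_itv /= => /andP[? ?]; apply: hd; rewrite ge_min le_max; apply/andP; split; apply/orP; [left|right].
have hc : {within `[x, y], continuous g}.
  apply: derivable_within_continuous => t /hd' h.
  exact: (@ex_derive _ _ _ _ _ _ _ h).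
have ho t : t \in `]x, y[%R -> is_derive t 1 g (dg t).
  by rewrite in_itv/= => /andP[/ltW ? /ltW ?]; apply: hd'; rewrite in_itv /=; apply/andP.
have [c cxy E] := MVT_segment xy ho hc.
rewrite E normrM ler_wpM2r//; apply: hB; move: cxy; rewrite in_itv /= => /andP[? ?].
by rewrite ge_min le_max; apply/andP; split; apply/orP; [left|right].
Qed.

(** Chain rule along a real line, seen on real and imaginary parts; it makes
    the real mean value theorem applicable to complex functions. *)
Lemma is_derive_line (f : C -> C) (z h d : C) (t : R) :
  is_derive (z + rc t * h) (1 : C) f d ->
  is_derive t 1 (fun t : R => re (f (z + rc t * h))) (re (h * d)) /\
  is_derive t 1 (fun t : R => im (f (z + rc t * h))) (im (h * d)).
Proof.
move=> /is_derive_ncP H.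
suff K e : 0 < e -> exists2 dl : R, 0 < dl & forall s : R, `|s| < dl ->
    nc (f (z + rc (t + s) * h) - f (z + rc t * h) - rc s * (h * d)) <= e * `|s|.
  split; apply/is_deriveP => e /K[dl dl0 Hd]; exists dl => // s /Hd;
    apply: le_trans.
  - by rewrite -re_rcM -!reB; exact: re_le_nc.
  - suff -> : s * im (h * d) = im (rc s * (h * d)).
      by rewrite -!imB; exact: im_le_nc.
    by rewrite [RHS]imM /= mul0r addr0.
move=> e0; have h1 : 0 < nc h + 1 by rewrite ltr_wpDl ?nc_ge0.
have [|dl dl0 Hd] := H (e / (nc h + 1)); first by rewrite divr_gt0.
exists (dl / (nc h + 1)); first by rewrite divr_gt0.
move=> s; rewrite ltr_pdivlMr// => hs.
have shE : nc (rc s * h) = `|s| * nc h by rewrite ncM nc_rc.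
have := Hd (rc s * h); rewrite shE => /(_ _)/le_trans; rewrite rcD mulrDl addrA mulrA.
apply.
- by apply: le_lt_trans hs; rewrite ler_wpM2l// lerDl.
- have -> : e / (nc h + 1) * (`|s| * nc h) = e * `|s| * (nc h / (nc h + 1)).
    by field; rewrite gt_eqF.
  rewrite ler_piMr//; first by rewrite mulr_ge0// ltW.
  by rewrite ler_pdivrMr// mul1r lerDl.
Qed.

(** A complex function need not attain its mean slope, so the real inequality
    is applied to the real and to the imaginary part separately; this costs
    the factor 2. *)
Lemma complex_mean_value (f df : C -> C) (z h : C) (B : R) :
  (forall t : R, 0 <= t <= 1 ->
     is_derive (z + rc t * h) (1 : C) f (df (z + rc t * h))) ->
  (forall t : R, 0 <= t <= 1 -> nc (df (z + rc t * h)) <= B) ->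
  nc (f (z + h) - f z) <= 2 * B * nc h.
Proof.
move=> hd hB.
have -> : f (z + h) - f z = f (z + rc 1 * h) - f (z + rc 0 * h).
  by rewrite rc1 mul1r rc0 mul0r addr0.
have hn (t : R) : 0 <= t <= 1 -> nc (h * df (z + rc t * h)) <= B * nc h.
  by move=> t01; rewrite ncM mulrC ler_wpM2r ?nc_ge0// hB.
have m01 (t : R) : (Num.min 0 1 <= t <= Num.max 0 1) = (0 <= t <= 1).
  by rewrite min_l ?max_r.
apply: le_trans (nc_le_reim _) _; rewrite -mulrA mulr_natl mulr2n reB imB.
apply: lerD.
- have := @real_mean_value (fun t => re (f (z + rc t * h)))
     (fun t => re (h * df (z + rc t * h))) (B * nc h) 0 1.
  rewrite subr0 normr1 mulr1; apply=> t; rewrite m01 => t01.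
  + by have [] := is_derive_line (hd t t01).
  + exact: le_trans (re_le_nc _) (hn _ t01).
- have := @real_mean_value (fun t => im (f (z + rc t * h)))
     (fun t => im (h * df (z + rc t * h))) (B * nc h) 0 1.
  rewrite subr0 normr1 mulr1; apply=> t; rewrite m01 => t01.
  + by have [] := is_derive_line (hd t t01).
  + exact: le_trans (im_le_nc _) (hn _ t01).
Qed.

End ComplexNorm.

(** * Locally uniform limits and the complex exponential *)

Section LimitTheorems.
Variable R : realType.
Local Notation C := (Cplx R).

Lemma derivable_nc_continuous (f : C -> C) (z : C) : derivable f z (1 : C) ->
  forall e : R, 0 < e -> exists2 dl : R, 0 < dl &
    forall h, nc h < dl -> nc (f (z + h) - f z) <= e.
Proof.
move=> /derivableP /is_derive_ncP H e e0; set d := 'D_1 f z in H.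
have [//|dl dl0 Hd] := H 1.
have d1 : 0 < nc d + 1 by rewrite ltr_wpDl ?nc_ge0.
exists (Num.min dl (e / (nc d + 1))); first by rewrite lt_min dl0 divr_gt0.
move=> h; rewrite lt_min => /andP[/Hd h1]; rewrite ltr_pdivlMr// => h2.
have -> : f (z + h) - f z = (f (z + h) - f z - h * d) + h * d by rewrite subrK.
apply: le_trans (ncD _ _) _; rewrite ncM.
by move: h1 h2; move: (nc h) (nc d) (nc _) => x y w; lra.
Qed.

(** A bound on every disk is required together with the Cauchy property, so
    that products stay in the class. *)
Definition loc_unif_cauchy (f : nat -> C -> C) :=
  forall r : R, (exists B : R, exists n0, forall n z, (n0 <= n)%N -> nc z <= r ->
     nc (f n z) <= B) /\
  forall e : R, 0 < e -> exists n0, forall n m z, (n0 <= n)%N -> (n0 <= m)%N ->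
     nc z <= r -> nc (f n z - f m z) <= e.

Lemma luc_cauchyseq f z : loc_unif_cauchy f -> cauchyseq (fun n => f n z).
Proof.
move=> /(_ (nc z))[_ H] e /H[n0 Hn]; exists n0 => n m hn hm.
exact: Hn.
Qed.

Lemma cauchyseq_luc (c : nat -> C) : cauchyseq c -> loc_unif_cauchy (fun n _ => c n).
Proof.
move=> H r; split; last first.
  by move=> e /H[n0 Hn]; exists n0 => n m _ hn hm _; exact: Hn.
have [//|n0 Hn] := H 1; exists (nc (c n0) + 1), n0 => n _ hn _.
rewrite -[c n](subrK (c n0)) addrC; apply: le_trans (ncD _ _) _.
by rewrite lerD2l; apply: Hn.
Qed.

Lemma luc_ext f g : (forall n z, f n z = g n z) -> loc_unif_cauchy f -> loc_unif_cauchy g.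
Proof.
move=> E; suff -> : f = g by [].
by apply/funext => n; apply/funext => z.
Qed.

Lemma lucD f g : loc_unif_cauchy f -> loc_unif_cauchy g -> loc_unif_cauchy (fun n z => f n z + g n z).
Proof.
move=> F G r; have [[B1 [n1 b1]] c1] := F r; have [[B2 [n2 b2]] c2] := G r.
split.
  exists (B1 + B2), (maxn n1 n2) => n z; rewrite geq_max => /andP[h1 h2] zr.
  by apply: le_trans (ncD _ _) _; apply: lerD; [exact: b1|exact: b2].
move=> e e0; have e20 : 0 < e / 2 by rewrite divr_gt0.
have [m1 k1] := c1 _ e20; have [m2 k2] := c2 _ e20.
exists (maxn m1 m2) => n m z; rewrite !geq_max => /andP[h1 h2] /andP[h3 h4] zr.
have -> : f n z + g n z - (f m z + g m z) = (f n z - f m z) + (g n z - g m z).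
  by ring.
apply: le_trans (ncD _ _) _; rewrite [e]splitr.
by apply: lerD; [exact: k1|exact: k2].
Qed.

Lemma lucM f g : loc_unif_cauchy f -> loc_unif_cauchy g -> loc_unif_cauchy (fun n z => f n z * g n z).
Proof.
move=> F G r; have [[B1 [n1 b1]] c1] := F r; have [[B2 [n2 b2]] c2] := G r.
split.
  exists (B1 * B2), (maxn n1 n2) => n z; rewrite geq_max => /andP[h1 h2] zr.
  by rewrite ncM ler_pM ?nc_ge0//; [exact: b1|exact: b2].
move=> e e0; set K := `|B1| + `|B2| + 1.
have K0 : 0 < K by rewrite ltr_wpDl// addr_ge0.
have eK0 : 0 < e / K by rewrite divr_gt0.
have [m1 k1] := c1 _ eK0; have [m2 k2] := c2 _ eK0.
exists (maxn (maxn n1 n2) (maxn m1 m2)) => n m z; rewrite !geq_max.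
move=> /andP[/andP[h1 h2] /andP[h3 h4]] /andP[/andP[h5 h6] /andP[h7 h8]] zr.
have -> : f n z * g n z - f m z * g m z =
   (f n z - f m z) * g n z + f m z * (g n z - g m z) by ring.
apply: le_trans (ncD _ _) _; rewrite !ncM.
have b2' := b2 n z h2 zr; have b1' := b1 m z h5 zr.
have k1' := k1 n m z h3 h7 zr; have k2' := k2 n m z h4 h8 zr.
have l1 := ler_norm B1; have l2 := ler_norm B2.
apply: (@le_trans _ _ (e / K * `|B2| + `|B1| * (e / K))).
  apply: lerD; apply: ler_pM; rewrite ?nc_ge0//.
    exact: le_trans b2' _.
  exact: le_trans b1' _.
have eE : e = e / K * K by rewrite divfK// gt_eqF.
rewrite [leRHS]eE; move: eK0; move: (e / K) => x x0.
by rewrite /K !mulrDr mulr1 addrC [`|B1| * x]mulrC lerDl ltW.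
Qed.

Lemma luc_sum (I : eqType) (s : seq I) (f : I -> nat -> C -> C) :
  (forall i, i \in s -> loc_unif_cauchy (f i)) -> loc_unif_cauchy (fun n z => \sum_(i <- s) f i n z).
Proof.
elim: s => [|i s IH] H.
  apply: (@luc_ext (fun _ _ => 0)); first by move=> *; rewrite big_nil.
  by apply: cauchyseq_luc => e e0; exists 0%N => *; rewrite subrr nc0 ltW.
have {}IH := IH (fun j js => H j (mem_behead (s := i :: s) js)).
by apply: luc_ext (lucD (H i (mem_head i s)) IH) => n z; rewrite big_cons.
Qed.

(** The difference of two members is controlled by its value at the origin
    and, through the mean value inequality, by the difference of the
    derivatives. *)
Lemma luc_primitive (f h : nat -> C -> C) :
  (forall n z, is_derive z (1 : C) (f n) (h n z)) -> loc_unif_cauchy h ->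
  cauchyseq (f^~ 0) -> loc_unif_cauchy f.
Proof.
move=> df H f0 r; have [[B [n1 b1]] c1] := H r.
have mvi n m z K : (forall w, nc w <= r -> nc (h n w - h m w) <= K) ->
    nc z <= r -> nc ((f n z - f m z) - (f n 0 - f m 0)) <= 2 * K * nc z.
  move=> HK zr; have := @complex_mean_value R (fun w => f n w - f m w)
     (fun w => h n w - h m w) 0 z K; rewrite add0r; apply.
  move=> t /andP[t0 t1]; apply: HK; rewrite add0r ncM nc_rc ger0_norm//.
  by apply: le_trans zr; rewrite ler_piMl ?nc_ge0.
have mvi1 n z K : (forall w, nc w <= r -> nc (h n w) <= K) ->
    nc z <= r -> nc (f n z - f n 0) <= 2 * K * nc z.
  move=> HK zr; have := @complex_mean_value R (f n) (h n) 0 z K; rewrite add0r; apply.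
  move=> t /andP[t0 t1]; apply: HK; rewrite add0r ncM nc_rc ger0_norm//.
  by apply: le_trans zr; rewrite ler_piMl ?nc_ge0.
split.
  have [[B0 [n0 b0]] _] := cauchyseq_luc f0 0.
  exists (2 * `|B| * r + B0), (maxn n1 n0) => n z.
  rewrite geq_max => /andP[h1 h0] zr.
  rewrite -[f n z](subrK (f n 0)); apply: le_trans (ncD _ _) _.
  apply: lerD; last by apply: (b0 _ 0) => //; rewrite nc0.
  apply: le_trans (mvi1 n z `|B| _ zr) _.
    by move=> w wr; apply: le_trans (b1 _ _ h1 wr) (ler_norm _).
  by rewrite ler_wpM2l// mulr_ge0.
move=> e e0; have [r0|r0] := ltP r 0.
  by exists 0%N => n m z _ _ zr; have := le_lt_trans zr r0; rewrite ltNge nc_ge0.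
have [|m0 k0] := f0 (e / 2); first by rewrite divr_gt0.
have [|m1 k1] := c1 (e / (4 * (r + 1))); first by rewrite divr_gt0// mulr_gt0// ltr_wpDl.
exists (maxn m0 m1) => n m z; rewrite !geq_max => /andP[h1 h2] /andP[h3 h4] zr.
rewrite -[_ - _](subrK (f n 0 - f m 0)); apply: le_trans (ncD _ _) _.
rewrite [e]splitr; apply: lerD; last exact: k0.
apply: le_trans (mvi n m z _ (fun w => k1 n m w h2 h4) zr) _.
have -> : e / 2 = 2 * (e / (4 * (r + 1))) * (r + 1).
  by field; rewrite gt_eqF// ltr_wpDl.
rewrite ler_wpM2l//.
  by rewrite mulr_ge0// divr_ge0 ?(ltW e0)// mulr_ge0// addr_ge0.
by rewrite (le_trans zr)// lerDl.
Qed.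

(** Subtract the affine function with slope [h n z] from [f n]. Up to the
    uniform Cauchy error the remainder has derivative [h n0 x - h n0 z] for
    one fixed index [n0], which is small near [z] by continuity; the resulting
    estimate is uniform in [n] and survives the limit. *)
Lemma luc_limit_derive (f h : nat -> C -> C) (F H : C -> C) :
  (forall n z, is_derive z (1 : C) (f n) (h n z)) ->
  (forall n z, derivable (h n) z (1 : C)) -> loc_unif_cauchy h ->
  (forall z, (f ^~ z) @ \oo --> F z) -> (forall z, (h ^~ z) @ \oo --> H z) ->
  forall z, is_derive z (1 : C) F (H z).
Proof.
move=> df dh lh cF cH z; apply/is_derive_ncP => e e0.
have e60 : 0 < e / 6 by rewrite divr_gt0.
have [_ /(_ _ e60)[n0 c1]] := lh (nc z + 1).
have [dl dl0 Hd] := derivable_nc_continuous (dh n0 z) e60.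
exists (Num.min dl 1); first by rewrite lt_min dl0 ltr01.
move=> w; rewrite lt_min => /andP[w1 w2].
pose u n := f n (z + w) - f n z - w * h n z.
have cu : u @ \oo --> F (z + w) - F z - w * H z.
  apply: cvgB; first by apply: cvgB; exact: cF.
  by apply: cvgM; [exact: cvg_cst|exact: cH].
apply: (cvg_bounded (n0 := n0)) cu _ => n hn; rewrite /u.
have zball (t : R) : 0 <= t <= 1 -> nc (rc t * w) <= nc w.
  by move=> /andP[t0 t1]; rewrite ncM nc_rc ger0_norm// ler_piMl// nc_ge0.
have := @complex_mean_value R (fun x => f n x - h n z * x) (fun x => h n x - h n z)
  z w (e / 2).
have -> : f n (z + w) - h n z * (z + w) - (f n z - h n z * z) =
   f n (z + w) - f n z - w * h n z by ring.
have -> : 2 * (e / 2) = e by field.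
apply.
  move=> t _ /=; apply: is_derive_fsub => //; rewrite -[X in is_derive _ _ _ X]mulr1.
  by apply: is_derive_fscale; exact: is_derive_fid.
move=> t t01; set x := z + rc t * w.
have xz : nc x <= nc z + 1.
  apply: le_trans (ncD _ _) _; rewrite lerD2l.
  by apply: le_trans (zball t t01) (ltW w2).
have -> : h n x - h n z = (h n x - h n0 x) + (h n0 x - h n0 z) + (h n0 z - h n z).
  by ring.
apply: le_trans (ncD _ _) _.
have -> : e / 2 = e / 6 + e / 6 + e / 6 by field.
apply: lerD; last by apply: c1 => //; rewrite lerDl.
apply: le_trans (ncD _ _) _; apply: lerD; first by apply: c1.
by apply: Hd; apply: le_lt_trans (zball t t01) w1.
Qed.

Lemma derive0_const (f : C -> C) : (forall z, is_derive z (1 : C) f 0) ->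
  forall z, f z = f 0.
Proof.
move=> H z; apply/eqP; rewrite -subr_eq0 -nc_eq0 -[X in f X]add0r.
rewrite eq_le nc_ge0 andbT.
have := @complex_mean_value R f (fun _ => 0) 0 z 0; rewrite mulr0 mul0r; apply=> //.
by move=> *; rewrite nc0.
Qed.

(** The series that occurs in the definition of [heat_evol]. *)
Definition cexp (z : C) : C := limn (series (fun k : nat => (k`!%:R)^-1 * z ^+ k)).

Let en (n : nat) (z : C) : C := series (fun k : nat => (k`!%:R)^-1 * z ^+ k) n.

Lemma en_tail (r : R) (z : C) n m : nc z <= r -> (n <= m)%N ->
  nc (en m z - en n z) <= series (exp_coeff r) m - series (exp_coeff r) n.
Proof.
move=> zr nm; have r0 : 0 <= r := le_trans (nc_ge0 _) zr.
rewrite /en !sub_series_geq//; apply: le_trans (nc_sum _ _ _) _.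
apply: ler_sum => i _; rewrite ncM ncV nc_nat ncX /exp_coeff mulrC.
by rewrite ler_wpM2r ?invr_ge0// lerXn2r ?nnegrE// nc_ge0.
Qed.

Lemma nc_en_le (r : R) (z : C) n : nc z <= r -> nc (en n z) <= expR r.
Proof.
move=> zr; have r0 : 0 <= r := le_trans (nc_ge0 _) zr.
have := en_tail zr (leq0n n).
have -> : en 0 z = 0 by rewrite /en /series /= big_geq.
have -> : series (exp_coeff r) 0 = 0 by rewrite /series /= big_geq.
rewrite !subr0 => /le_trans; apply.
apply: nondecreasing_cvgn_le (is_cvg_series_exp_coeff r) n.
by apply: nondecreasing_series => k _ _; exact: exp_coeff_ge0.
Qed.

Lemma luc_en : loc_unif_cauchy en.
Proof.
move=> r; split.
  by exists (expR r), 0%N => n z _ zr; exact: nc_en_le.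
move=> e e0.
have : cvgn (series (exp_coeff r)) by exact: is_cvg_series_exp_coeff.
set l := limn _ => /cvgrPdist_le /(_ (e / 2)) [|n0 _ Hn]; first by rewrite divr_gt0.
exists n0 => n m z.
wlog nm : n m / (n <= m)%N => [W|hn hm zr].
  by case/orP: (leq_total n m) => nm hn hm zr; [|rewrite nc_distC]; apply: W.
rewrite nc_distC; apply: le_trans (en_tail zr nm) _.
have := Hn n hn; have := Hn m hm; rewrite /= !ler_norml => /andP[h1 _] /andP[_ h2].
move: h1 h2; move: (series _ n) (series _ m) => x y; lra.
Qed.

Lemma cvg_cexp z : (en ^~ z) @ \oo --> cexp z.
Proof. exact: cauchyseq_cvg (luc_cauchyseq z luc_en). Qed.

Lemma is_derive_en n z : is_derive z (1 : C) (en n.+1) (en n z).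
Proof.
have -> : en n.+1 = (fun z : C => \sum_(i < n.+1) (i`!%:R)^-1 * z ^+ i).
  by apply/funext => w; rewrite /en /series /= big_mkord.
have -> : en n z = \sum_(i < n.+1) ((i`!%:R)^-1 * (i%:R * z ^+ i.-1)).
  rewrite /en /series /= big_mkord big_ord_recl /= mul0r mulr0 add0r.
  apply: eq_bigr => i _; rewrite /bump /= add1n /= factS natrM invfM.
  by rewrite mulrACA mulVf ?pnatr_eq0// mul1r.
by apply: is_derive_fsum => i _; apply: is_derive_fscale; exact: is_derive_fpow.
Qed.

Lemma is_derive_cexp z : is_derive z (1 : C) cexp (cexp z).
Proof.
have shift (z' : C) : (fun n => en n.+1 z') @ \oo --> cexp z'.
  by have := @cvg_cexp z'; rewrite -cvg_shiftS.
have den n w : derivable (en n) w (1 : C).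
  case: n => [|n]; last exact: (@ex_derive _ _ _ _ _ _ _ (is_derive_en n w)).
  rewrite (_ : en 0 = cst 0); first exact: derivable_cst.
  by apply/funext => x; rewrite /en /series /= big_geq.
exact: (luc_limit_derive is_derive_en den luc_en shift cvg_cexp).
Qed.

Lemma cexp0 : cexp 0 = 1.
Proof.
apply: cvg_lim => //; apply/cvgn_ncP => e e0; exists 1%N => [] [//|n] _.
rewrite /series /= big_nat_recl//= big1; first by rewrite invr1 expr0 mul1r addr0 subrr nc0 ltW.
by move=> i _; rewrite expr0n mulr0.
Qed.

Lemma nc_cexp z : nc (cexp z) <= expR (nc z).
Proof.
by apply: (cvg_bounded (n0 := 0%N)) (@cvg_cexp z) _ => n _; exact: nc_en_le.
Qed.

Lemma is_derive_cexpM (c z : C) :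
  is_derive z (1 : C) (fun z => cexp (c * z)) (c * cexp (c * z)).
Proof.
apply/is_derive_ncP => e e0.
have /is_derive_ncP H := is_derive_cexp (c * z).
have c1 : 0 < nc c + 1 by rewrite ltr_wpDl ?nc_ge0.
have [|dl dl0 Hd] := H (e / (nc c + 1)); first by rewrite divr_gt0.
exists (dl / (nc c + 1)); first by rewrite divr_gt0.
move=> h; rewrite ltr_pdivlMr// => hh.
have := Hd (c * h); rewrite ncM => /(_ _)/le_trans.
rewrite mulrDr [h * (c * _)]mulrA [h * c]mulrC; apply.
  apply: le_lt_trans hh; rewrite mulrC ler_wpM2l ?nc_ge0//.
  by rewrite lerDl.
rewrite mulrA ler_wpM2r ?nc_ge0// mulrAC -mulrA ger_pMr//.
by rewrite ler_pdivrMr// mul1r lerDl.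
Qed.

(** The product has zero derivative; this replaces the addition theorem. *)
Lemma cexp_mulN (c z : C) : cexp (c * z) * cexp (- c * z) = 1.
Proof.
(* the derivative of the product, with the two exponentials as variables *)
have E (x a b : C) : a * (- x * b) + b * (x * a) = 0 by ring.
have H w : is_derive w (1 : C) (fun z => cexp (c * z) * cexp (- c * z)) 0.
  rewrite -[X in is_derive _ _ _ X](E c (cexp (c * w)) (cexp (- c * w))).
  by apply: is_derive_fmul; exact: is_derive_cexpM.
by rewrite (derive0_const H z) !mulr0 cexp0 mulr1.
Qed.

(** On a disk the exponents stay bounded, and there the exponential is
    Lipschitz. *)
Lemma luc_cexpM (c : nat -> C) : cauchyseq c -> loc_unif_cauchy (fun n z => cexp (c n * z)).
Proof.
move=> Hc r; have [[B [n0 b0]] _] := cauchyseq_luc Hc 0.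
have bnd n z : (n0 <= n)%N -> nc z <= r -> nc (c n * z) <= `|B| * r.
  move=> hn zr; rewrite ncM; apply: ler_pM; rewrite ?nc_ge0//.
  by apply: le_trans (ler_norm _); apply: (b0 _ 0) => //; rewrite nc0.
split.
  exists (expR (`|B| * r)), n0 => n z hn zr; apply: le_trans (nc_cexp _) _.
  by rewrite ler_expR bnd.
move=> e e0; have [r0|r0] := ltP r 0.
  by exists 0%N => n m z _ _ zr; have := le_lt_trans zr r0; rewrite ltNge nc_ge0.
(* a point of the segment between the two exponents has modulus at most 3 |B|
   r *)
set K := expR (3 * (`|B| * r)).
have K0 : 0 < K by exact: expR_gt0.
have [|n1 Hn] := Hc (e / (2 * K * (r + 1))).
  by rewrite divr_gt0// !mulr_gt0// ltr_wpDl.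
exists (maxn n0 n1) => n m z; rewrite !geq_max => /andP[h1 h2] /andP[h3 h4] zr.
have bK (t : R) : 0 <= t <= 1 ->
    nc (cexp (c m * z + rc t * (c n * z - c m * z))) <= K.
  move=> /andP[t0 t1]; apply: le_trans (nc_cexp _) _; rewrite ler_expR.
  apply: le_trans (ncD _ _) _.
  have -> : 3 * (`|B| * r) = `|B| * r + (`|B| * r + `|B| * r) by ring.
  apply: lerD; first exact: bnd.
  rewrite ncM nc_rc ger0_norm//; apply: le_trans (_ : nc (c n * z - c m * z) <= _).
    by rewrite ler_piMl ?nc_ge0.
  by apply: le_trans (ncB _ _) _; apply: lerD; exact: bnd.
have := complex_mean_value (fun t _ => is_derive_cexp _) bK.
rewrite [c m * z + _]addrC subrK => /le_trans; apply.
rewrite -mulrBl ncM.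
have -> : e = 2 * K * (e / (2 * K * (r + 1)) * (r + 1)).
  by field; rewrite (gt_eqF K0) gt_eqF// ltr_wpDl.
rewrite ler_wpM2l//; first by rewrite mulr_ge0// ltW.
apply: ler_pM; rewrite ?nc_ge0//; first exact: Hn.
by rewrite (le_trans zr)// lerDl.
Qed.

End LimitTheorems.

(** * Moments of the roots under the multiplicative heat flow *)

Section HeatFlowMoments.
Variable R : realType.
Local Notation C := (Cplx R).

(** The monomial of degree [j] is an eigenvector with eigenvalue (j+1)(j-N);
    in particular the leading coefficient of a polynomial of degree N is fixed
    by the flow. *)
Lemma coef_heat_gen N (p : {poly C}) j :
  (heat_gen N p)`_j = (j%:R + 1) * (j%:R - N%:R) * p`_j.
Proof.
rewrite /heat_gen !coefB !coefZ coefXnM coefXM coef_derivn coef_deriv.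
case: j => [|[|j]] /=.
- ring.
- ring.
- rewrite subSS subSS subn0 add2n; have -> : (j.+2 ^_ 2 = j.+2 * j.+1)%N by rewrite ffactnS ffactn1.
  have e1 : j.+1%:R = j%:R + 1 :> C by rewrite natr1.
  have e2 : j.+2%:R = j%:R + 1 + 1 :> C by rewrite natr1 natr1.
  rewrite -[_ *+ (_ * _)]mulr_natr -[p`_j.+2 *+ _]mulr_natr natrM e1 e2; ring.
Qed.

Lemma coef_iter_heat_gen N (p : {poly C}) j k :
  (iter k (heat_gen N) p)`_j = ((j%:R + 1) * (j%:R - N%:R)) ^+ k * p`_j.
Proof.
elim: k => [|k IH]; first by rewrite expr0 mul1r.
by rewrite iterS coef_heat_gen IH exprS mulrA.
Qed.

(** The exponential rate in tau of the coefficient of degree [j]. *)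
Definition heat_rate N j : C := - ((j%:R + 1) * (j%:R - N%:R)) / (2 * N%:R).

Lemma heat_evolE N tau (p : {poly C}) :
  heat_evol N tau p = \poly_(j < size p) (cexp (heat_rate N j * tau) * p`_j).
Proof.
apply/polyP => j; rewrite !coef_poly; case: ifP => // _.
apply: cvg_lim => //.
set z := heat_rate N j * tau.
rewrite (_ : series _ = fun n => series (fun k => (k`!%:R)^-1 * z ^+ k) n * p`_j).
  by apply: cvgM; [exact: cvg_cexp|exact: cvg_cst].
apply/funext => n; rewrite /series /= mulr_suml; apply: eq_bigr => k _.
rewrite coef_iter_heat_gen mulrA -!mulrA; congr (_ * _); rewrite mulrA -exprMn.
by congr (_ ^+ _ * _); rewrite /z /heat_rate !mulrA; ring.
Qed.

(** The reciprocal polynomial of the monic polynomial with roots [s]. Its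
    logarithmic derivative generates the power sums. *)
Definition recip_prod (s : seq C) : {poly C} := \prod_(z <- s) (1 - z%:P * 'X).

Lemma recip_prod_cons z s : recip_prod (z :: s) = (1 - z%:P * 'X) * recip_prod s.
Proof. exact: big_cons. Qed.

Lemma size_recip_prod (s : seq C) : (size (recip_prod s) <= (size s).+1)%N.
Proof.
elim: s => [|z s IH]; first by rewrite /recip_prod big_nil size_poly1.
rewrite /recip_prod big_cons -/(recip_prod s) mulrBl mul1r.
apply: leq_trans (size_polyD _ _) _; rewrite geq_max size_polyN (leq_trans IH)//=.
rewrite -mulrA mul_polyC; apply: leq_trans (size_scale_leq _ _) _.
apply: leq_trans (size_polyMleq _ _) _; rewrite size_polyX.
by rewrite add2n.
Qed.

Lemma coef_recip_prod (s : seq C) k : (k <= size s)%N ->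
  (recip_prod s)`_k = (\prod_(z <- s) ('X - z%:P))`_(size s - k).
Proof.
elim: s k => [|z s IH] k /=; first by rewrite leqn0 => /eqP->; rewrite /recip_prod !big_nil.
rewrite /recip_prod !big_cons -/(recip_prod s) => hk.
rewrite mulrBl mul1r mulrBl !coefB -mulrA !coefCM !coefXM.
case: k hk => [|k] hk.
  rewrite mulr0 subr0 subn0 /= IH// subn0.
  suff -> : (\prod_(z <- s) ('X - z%:P))`_(size s).+1 = 0 by rewrite mulr0 subr0.
  by rewrite nth_default// size_prod_XsubC.
rewrite ltnS in hk; rewrite subSS /= (IH k)//.
move: hk; rewrite leq_eqVlt => /predU1P[->|hk].
  rewrite subnn /= (_ : (recip_prod s)`_(size s).+1 = 0) //.
  by rewrite nth_default// ?size_recip_prod.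
rewrite IH// subn_eq0 leqNgt hk /=; congr (_`_ _ - _); lia.
Qed.

(** The value at order 0 is set to 0, so that the generating function of the
    power sums has no constant term, as in - X F' / F. *)
Definition power_sum (s : seq C) (a : nat) : C :=
  if a is 0%N then 0 else \sum_(z <- s) z ^+ a.

(** Newton's identities as - theta F = P F modulo X^(n+1). Adding a root [z]
    multiplies F by 1 - z X and adds the geometric sum of (z X)^a to P, which
    telescopes against 1 - z X. *)
Lemma newton_recip_prod (s : seq C) n : exists r : {poly C},
  'X * (recip_prod s)^`() + (\poly_(a < n.+1) power_sum s a) * recip_prod s = 'X^(n.+1) * r.
Proof.
have psE t : \poly_(a < n.+1) power_sum t a =
    \sum_(z <- t) \sum_(1 <= a < n.+1) (z%:P * 'X) ^+ a.
  apply/polyP => i; rewrite coef_poly coef_sum.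
  have E (z : C) : (\sum_(1 <= a < n.+1) (z%:P * 'X) ^+ a)`_i =
      if (0 < i < n.+1)%N then z ^+ i else 0.
    rewrite coef_sum; case: ifPn => hi.
      rewrite (bigD1_seq i) ?iota_uniq ?mem_index_iota//= big1.
        by rewrite exprMn -polyC_exp coefCM coefXn eqxx mulr1 addr0.
      by move=> a ai; rewrite exprMn -polyC_exp coefCM coefXn eq_sym (negbTE ai) mulr0.
    rewrite big_seq big1// => a; rewrite mem_index_iota => ha.
    rewrite exprMn -polyC_exp coefCM coefXn; case: eqP => [ia|]; last by rewrite mulr0.
    by rewrite ia ha in hi.
  under eq_bigr do rewrite E.
  case: i {E} => [|i] /=; first by rewrite big1.
  by case: ifP => _ //; rewrite big1.
rewrite psE; elim: s => [|z s [r IH]].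
  by exists 0; rewrite /recip_prod !big_nil derivC mulr0 mul0r mulr0 addr0.
rewrite big_cons recip_prod_cons derivM derivB derivM !derivC derivX.
have geo : (\sum_(1 <= a < n.+1) (z%:P * 'X) ^+ a) * (1 - z%:P * 'X) =
    z%:P * 'X - (z%:P * 'X) ^+ n.+1.
  elim: n {psE IH} => [|n IHn]; first by rewrite big_geq// mul0r expr1 subrr.
  rewrite big_nat_recr//= mulrDl IHn !exprS; ring.
exists ((1 - z%:P * 'X) * r - z%:P ^+ n.+1 * recip_prod s).
move: IH geo; rewrite exprMn.
move: (\sum_(_ <- _) _) => S; move: (\sum_(_ <= _ < _) _) => T.
move: (_^`()) => f'; move: (recip_prod s) => f; move: ('X^_) => Y; move: (_ ^+ n.+1) => zn.
move=> IH geo.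
have -> : 'X * ((0 - (0 * 'X + z%:P * 1)) * f + (1 - z%:P * 'X) * f') +
   (T + S) * ((1 - z%:P * 'X) * f) =
   - (z%:P * 'X) * f + (T * (1 - z%:P * 'X)) * f + (1 - z%:P * 'X) * ('X * f' + S * f)
  by ring.
by rewrite IH geo; ring.
Qed.

(** The Euler operator X d/dX, acting on coefficients by multiplication with
    the degree. *)
Definition theta (p : {poly C}) : {poly C} := 'X * p^`().

Lemma coef_theta p i : (theta p)`_i = i%:R * p`_i.
Proof.
rewrite /theta coefXM coef_deriv; case: i => [|i] /=; first by rewrite mul0r.
by rewrite mulr_natl.
Qed.

(** If the coefficients [c] move with velocity [d], differentiating Newton's
    identities gives a triangular linear system for the velocities of the
    power sums [m], and [G] solves it. In generating functions, with H = (N+1)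
    Q - theta Q + Q^2, the relation theta F = - Q F gives (N+1) theta F -
    theta^2 F = - F H, and theta (F H) = F (theta H - Q H). Power series are
    replaced by polynomials up to degree [n]. *)
Lemma newton_flow (N : C) (m c : nat -> C) : N != 0 ->
  (forall a, \sum_(b < a.+1) m b * c (a - b)%N = - (a%:R * c a)) ->
  let d k := k%:R * (N + 1 - k%:R) / (2 * N) * c k in
  let G a := a%:R / (2 * N) *
     ((N + 1 - a%:R) * m a + \sum_(b < a.+1) m b * m (a - b)%N) in
  forall a, \sum_(b < a.+1) (G b * c (a - b)%N + m b * d (a - b)%N) = - (a%:R * d a).
Proof.
move=> N0 newton d G n.
pose Q := \poly_(i < n.+1) m i; pose F := \poly_(i < n.+1) c i.
(* being zero modulo X^(n+1): an ideal stable under theta *)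
pose low (p : {poly C}) := forall i, (i <= n)%N -> p`_i = 0.
have lowD p q : low p -> low q -> low (p + q).
  by move=> lp lq i hi; rewrite coefD lp// lq// addr0.
have lowM p q : low p -> low (q * p).
  move=> lp i hi; rewrite coefM big1// => j _; rewrite lp ?mulr0//.
  by rewrite (leq_trans (leq_subr _ _)).
have lowN p : low p -> low (- p).
  by move=> lp i hi; rewrite coefN lp// oppr0.
have lowT p : low p -> low (theta p).
  by move=> lp i hi; rewrite coef_theta lp// mulr0.
pose k := (N + 1)%:P : {poly C}.
pose H := k * Q - theta Q + Q ^+ 2.
pose D := k * theta F - theta (theta F).
pose E := theta F + Q * F.
have conv (u v : nat -> C) i : (i <= n)%N ->
    ((\poly_(j < n.+1) u j) * (\poly_(j < n.+1) v j))`_i =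
    \sum_(b < i.+1) u b * v (i - b)%N.
  move=> hi; rewrite coefM; apply: eq_bigr => b _.
  have hb : (b <= i)%N by rewrite -ltnS.
  by rewrite !coef_poly !ltnS (leq_trans hb hi) (leq_trans (leq_subr _ _) hi).
have lowE : low E.
  move=> i hi; rewrite coefD coef_theta conv// newton coef_poly ltnS hi.
  exact: subrr.
have key : low (theta H * F + Q * D + theta D).
  have -> : theta H * F + Q * D + theta D =
     Q * (k * E + Q * E - theta E) + - (H * E) + theta (k * E + Q * E - theta E).
    rewrite /D /H /E /theta /k.
    rewrite !(expr2, derivD, derivM, derivN, derivX, derivC); ring.
  have lowE' : low (k * E + Q * E - theta E).
    by apply: (lowD); [apply: (lowD); exact: lowM|exact/lowN/lowT].
  by apply: (lowD); [apply: (lowD); [exact: lowM|exact/lowN/lowM]|exact: lowT].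
have := key n (leqnn n).
have HG i : (i <= n)%N -> (theta H)`_i = 2 * N * G i.
  move=> hi; rewrite coef_theta /H coefD coefB coefCM coef_theta expr2 conv//.
  by rewrite coef_poly ltnS hi /G; field.
have Dd i : (i <= n)%N -> D`_i = 2 * N * d i.
  move=> hi; rewrite /D coefB coefCM !coef_theta coef_poly ltnS hi /d; field.
  exact: N0.
rewrite !coefD coef_theta Dd// !coefM -big_split /=.
rewrite (eq_bigr (fun b : 'I_n.+1 =>
   2 * N * (G b * c (n - b)%N + m b * d (n - b)%N))); last first.
  move=> b _; have hb : (b <= n)%N by rewrite -ltnS.
  rewrite HG// Dd ?leq_subr// !coef_poly ltn_ord ltnS leq_subr; ring.
rewrite -mulr_sumr mulrCA -mulrDr => /eqP.
rewrite !mulf_eq0 pnatr_eq0 (negbTE N0) /= addr_eq0 => /eqP //.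
Qed.

Lemma newton_identity (s : seq C) a :
  \sum_(b < a.+1) power_sum s b * (recip_prod s)`_(a - b) = - (a%:R * (recip_prod s)`_a).
Proof.
have [r /(congr1 (fun p : {poly C} => p`_a))] := newton_recip_prod s a.
rewrite coefD (coef_theta (recip_prod s)) coefM coefXnM leqnn => /eqP.
rewrite addrC addr_eq0 => /eqP <-; apply: eq_bigr => b _.
by rewrite coef_poly ltn_ord.
Qed.

Section RootsOfEvolution.
Variables (N : nat) (p : {poly C}).
Hypotheses (N0 : (0 < N)%N) (sp : size p = N.+1).
Let s tau := mroots (heat_evol N tau p).

Let pN0 : p`_N != 0.
Proof. by have := lead_coef_eq0 p; rewrite lead_coefE sp /= -size_poly_eq0 sp => ->. Qed.

Let coefN tau : (heat_evol N tau p)`_N = p`_N.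
Proof.
rewrite heat_evolE coef_poly sp ltnSn /heat_rate subrr mulr0 oppr0 !mul0r cexp0.
by rewrite mul1r.
Qed.

Let size_evol tau : size (heat_evol N tau p) = N.+1.
Proof.
apply/eqP; rewrite eqn_leq; apply/andP; split.
  by rewrite heat_evolE -sp size_poly.
by rewrite ltnNge; apply: contraNN pN0 => /leq_sizeP/(_ N (leqnn N)); rewrite coefN => ->.
Qed.

Let evolE tau : heat_evol N tau p = p`_N *: \prod_(z <- s tau) ('X - z%:P).
Proof.
rewrite /s /mroots; case: closed_field_poly_normal => r /= E.
by rewrite {1}E lead_coefE size_evol /= coefN.
Qed.

(** The leading coefficient is constant along the flow, so no root escapes to
    infinity. *)
Lemma size_mroots tau : size (s tau) = N.
Proof.
have := size_evol tau; rewrite evolE size_scale// size_prod_XsubC.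
by move=> [].
Qed.

Lemma coef_recip_prod_evol tau k : (recip_prod (s tau))`_k =
  if (k <= N)%N then p`_(N - k) / p`_N * cexp (heat_rate N (N - k) * tau) else 0.
Proof.
case: leqP => hk; last by rewrite nth_default// (leq_trans (size_recip_prod _))// size_mroots.
rewrite coef_recip_prod size_mroots//.
have := evolE tau => /(congr1 (fun q : {poly C} => q`_(N - k))).
rewrite coefZ heat_evolE coef_poly sp ltnS leq_subr => E.
by apply: (mulfI pN0); rewrite -E mulrCA mulrC mulrA divfK// mulrC.
Qed.

Lemma is_derive_recip_prod_evol tau k :
  is_derive tau (1 : C) (fun t => (recip_prod (s t))`_k)
   (k%:R * (N%:R + 1 - k%:R) / (2 * N%:R) * (recip_prod (s tau))`_k).
Proof.
under eq_fun do rewrite coef_recip_prod_evol; rewrite coef_recip_prod_evol.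
case: leqP => hk; last by rewrite mulr0; exact: is_derive_fcst.
rewrite mulrCA; apply: is_derive_fscale.
rewrite (_ : _ / _ = heat_rate N (N - k)); first exact: is_derive_cexpM.
by rewrite /heat_rate natrB//; congr (_ / _); ring.
Qed.

(** Strong induction along Newton's recursion m_a = - a c_a - sum_(b < a) m_b
    c_(a-b): it gives differentiability, since the right-hand side involves
    only lower power sums, and [newton_flow] identifies the derivative. *)
Lemma is_derive_power_sum a tau :
  is_derive tau (1 : C) (fun t => power_sum (s t) a)
   (a%:R / (2 * N%:R) * ((N%:R + 1 - a%:R) * power_sum (s tau) a
     + \sum_(b < a.+1) power_sum (s tau) b * power_sum (s tau) (a - b))).
Proof.
have NC0 : N%:R != 0 :> C by rewrite pnatr_eq0 -lt0n.
elim/ltn_ind: a => a IH.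
set c := fun t k => (recip_prod (s t))`_k.
have c0 t : c t 0%N = 1.
  by rewrite /c coef_recip_prod_evol /= subn0 divff// mul1r /heat_rate subrr mulr0 oppr0 !mul0r cexp0.
have := @newton_flow N%:R (power_sum (s tau)) (c tau) NC0 (newton_identity (s tau)).
set d := fun k : nat => _; set G := fun a : nat => _; rewrite /= => /(_ a).
rewrite big_ord_recr /= subnn c0 mulr1 (_ : d 0%N = 0); last by rewrite /d !mul0r.
rewrite mulr0 addr0 => /eqP; rewrite addrC eq_sym -subr_eq => /eqP Ga.
rewrite -/(G a) -Ga.
have -> : (fun t => power_sum (s t) a) =
    (fun t => - (a%:R * c t a) - \sum_(b < a) power_sum (s t) b * c t (a - b)%N).
  apply/funext => t; have := newton_identity (s t) a.
  rewrite big_ord_recr /= subnn -/(c t 0%N) c0 mulr1 => <-.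
  by rewrite [X in X - _]addrC addrK.
have Dc t k : is_derive t (1 : C) (fun t => c t k) (k%:R * (N%:R + 1 - k%:R) / (2 * N%:R) * c t k).
  exact: is_derive_recip_prod_evol.
have H1 : is_derive tau (1 : C) (fun t => - (a%:R * c t a)) (- (a%:R * d a)).
  rewrite -mulNr; under eq_fun do rewrite -mulNr.
  by apply: is_derive_fscale; exact: Dc.
apply: (is_derive_fsub H1); apply: is_derive_fsum => b _; rewrite addrC [G b * _]mulrC.
exact: (is_derive_fmul (IH b (ltn_ord b)) (Dc _ _)).
Qed.

End RootsOfEvolution.

Lemma root_moment_power_sum N (p : {poly C}) a tau : (0 < a)%N ->
  root_moment N p a tau = N%:R^-1 * power_sum (mroots (heat_evol N tau p)) a.
Proof. by case: a. Qed.

(** For N = 0 all moments vanish because the inverse of zero is zero;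
    including this case lets sequences be indexed by all N. *)
Lemma root_moment_ode N (p : {poly C}) : ((0 < N)%N -> size p = N.+1) ->
  forall a tau, is_derive tau (1 : C) (root_moment N p a)
    (a%:R / 2 * root_moment N p a tau
     + a%:R / 2 * (\sum_(1 <= b < a)
         root_moment N p b tau * root_moment N p (a - b) tau)
     - a%:R * (a%:R - 1) / (2 * N%:R) * root_moment N p a tau).
Proof.
case: (posnP N) => [->|N0] sp a tau.
  have E b : root_moment 0 p b = fun=> 0.
    by apply/funext => t; rewrite /root_moment invr0 mul0r.
  rewrite E; under eq_bigr do rewrite E mul0r.
  rewrite big1// !mulr0 addr0 subr0; exact: is_derive_fcst.
have {}sp := sp isT; have NC0 : N%:R != 0 :> C by rewrite pnatr_eq0 -lt0n.
case: a => [|a].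
  rewrite !mul0r addr0 subr0.
  have -> : root_moment N p 0 = fun=> 1; last exact: is_derive_fcst.
  apply/funext => t; rewrite /root_moment; under eq_bigr do rewrite expr0.
  rewrite big_const_seq count_predT size_mroots// iter_addr_0 mulVf//.
have -> : root_moment N p a.+1 = fun t => N%:R^-1 * power_sum (mroots (heat_evol N t p)) a.+1.
  by apply/funext => t; rewrite root_moment_power_sum.
have := is_derive_fscale N%:R^-1 (is_derive_power_sum N0 sp a.+1 tau).
set D := (X in is_derive _ _ _ X); set D' := (X in _ -> is_derive _ _ _ X).
suff -> : D' = D by [].
rewrite /D /D' big_ord_recl big_ord_recr /= mul0r add0r subnn mulr0 addr0.
rewrite -(big_mkord xpredT (fun b => power_sum _ b.+1 * power_sum _ (a.+1 - b.+1))).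
rewrite big_add1 /=.
rewrite (eq_big_nat _ _ (F2 := fun b => N%:R^-1 ^+ 2 * (power_sum (mroots (heat_evol N tau p)) b.+1 * power_sum (mroots (heat_evol N tau p)) (a.+1 - b.+1)))); last first.
  by move=> b /andP[_ hb]; rewrite !root_moment_power_sum ?subn_gt0 ?ltnS//; ring.
rewrite -mulr_sumr; move: (\sum_(_ <= _ < _) _) => S.
by field.
Qed.

End HeatFlowMoments.

(** * The limit of many roots *)

Section LargeN.
Variable R : realType.
Local Notation C := (Cplx R).

(** Integrating factor: exp(- kap z) f has derivative exp(- kap z) g, and
    primitives of locally uniformly Cauchy sequences are again such. *)
Lemma linear_ode_luc (kap : nat -> C) (f g : nat -> C -> C) :
  cauchyseq kap ->
  (forall n z, is_derive z (1 : C) (f n) (kap n * f n z + g n z)) ->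
  loc_unif_cauchy g -> cauchyseq (f^~ 0) -> loc_unif_cauchy f.
Proof.
move=> ck df lg cf.
have ckN : cauchyseq (fun n => - kap n).
  move=> e /ck[n0 H]; exists n0 => n m hn hm.
  by rewrite -opprD ncN; exact: H.
have du n z : is_derive z (1 : C) (fun z => cexp (- kap n * z) * f n z)
    (cexp (- kap n * z) * g n z).
  have := is_derive_fmul (is_derive_cexpM (- kap n) z) (df n z).
  set D := (X in is_derive _ _ _ X -> _); rewrite (_ : D = cexp (- kap n * z) * g n z)//.
  by rewrite /D; ring.
have u0 : cauchyseq ((fun n z => cexp (- kap n * z) * f n z)^~ 0).
  move=> e /cf[n0 H]; exists n0 => n m hn hm.
  by rewrite !mulr0 cexp0 !mul1r; exact: H.
have lu := luc_primitive du (lucM (luc_cexpM ckN) lg) u0.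
apply: luc_ext (lucM (luc_cexpM ck) lu) => n z.
by rewrite mulrA cexp_mulN mul1r.
Qed.

Lemma cvg_inv_nat : (fun n => (n%:R : C)^-1) @ \oo --> (0 : C).
Proof.
apply/cvgn_ncP => e e0; have [n0 _ H] := near_infty_natSinv_lt (PosNum e0).
exists n0.+1 => [] [//|n]; rewrite ltnS => /H /= /ltW.
by rewrite subr0 ncV nc_nat.
Qed.

Section MomentLimits.
Variable p : nat -> {poly C}.
Hypothesis sp : forall N : nat, (0 < N)%N -> size (p N) = N.+1.
Hypothesis cp : forall a : nat, cvgn (fun N : nat => root_moment N (p N) a 0).

Let m a N := root_moment N (p N) a.
Let kap a N : C := a%:R / 2 - a%:R * (a%:R - 1) / 2 * N%:R^-1.
Let conv a N tau : C := a%:R / 2 * \sum_(1 <= b < a) m b N tau * m (a - b) N tau.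

Let cvg_kap a : kap a @ \oo --> (a%:R / 2 : C).
Proof.
rewrite -[X in _ --> X]subr0 -[X in _ - X](mulr0 (a%:R * (a%:R - 1) / 2)).
by apply: cvgB; [exact: cvg_cst|apply: cvgMr; exact: cvg_inv_nat].
Qed.

Let ode a N tau : is_derive tau (1 : C) (m a N) (kap a N * m a N tau + conv a N tau).
Proof.
have := root_moment_ode (@sp N) a tau.
set D := (X in is_derive _ _ _ X -> _).
rewrite (_ : D = kap a N * m a N tau + conv a N tau)//.
by rewrite /D /kap /conv /m invfM; ring.
Qed.

(** The inhomogeneous term in the equation of order [a] involves lower moments
    only. *)
Lemma luc_root_moment a : loc_unif_cauchy (m a).
Proof.
elim/ltn_ind: a => a IH.
have lc : loc_unif_cauchy (conv a).
  apply: (lucM (f := fun _ _ => a%:R / 2)).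
    by apply: cauchyseq_luc => e e0; exists 0%N => *; rewrite subrr nc0 ltW.
  apply: luc_sum => b; rewrite mem_index_iota => /andP[b1 ba].
  by apply: lucM; apply: IH => //; lia.
have c0 : cauchyseq ((m a)^~ 0) by apply: cvg_cauchyseq; exact: cp.
have ck : cauchyseq (kap a) by apply: cvg_cauchyseq; exact: cvgP (@cvg_kap a).
exact: (linear_ode_luc ck (ode a) lc c0).
Qed.

Let M a tau : C := limn (fun N => m a N tau).

Lemma cvg_root_moment a tau : (fun N => m a N tau) @ \oo --> M a tau.
Proof. exact: cauchyseq_cvg (luc_cauchyseq tau (luc_root_moment a)). Qed.

Lemma limit_moment_ode a tau : is_derive tau (1 : C) (M a)
  (a%:R / 2 * M a tau + a%:R / 2 * (\sum_(1 <= b < a) M b tau * M (a - b)%N tau)).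
Proof.
pose h N z := kap a N * m a N z + conv a N z.
pose H z := a%:R / 2 * M a z + a%:R / 2 * (\sum_(1 <= b < a) M b z * M (a - b)%N z).
have dm b N z : derivable (m b N) z (1 : C).
  exact: (@ex_derive _ _ _ _ _ _ _ (ode b N z)).
have dh N z : derivable (h N) z (1 : C).
  have dmP b := derivableP (dm b N z).
  apply: (@ex_derive _ _ _ _ _ _ _ (is_derive_fadd (is_derive_fscale (kap a N) (dmP a))
    (is_derive_fscale (a%:R / 2) (is_derive_fsum (s := index_iota 1 a)
       (fun b _ => is_derive_fmul (dmP b) (dmP (a - b)%N)))))).
have lh : loc_unif_cauchy h.
  apply: lucD.
    apply: lucM (luc_root_moment a); apply: cauchyseq_luc.
    by apply: cvg_cauchyseq; exact: cvgP (@cvg_kap a).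
  apply: (lucM (f := fun _ _ => a%:R / 2)).
    by apply: cauchyseq_luc => e e0; exists 0%N => *; rewrite subrr nc0 ltW.
  by apply: luc_sum => b _; apply: lucM; exact: luc_root_moment.
have cH z : (h^~ z) @ \oo --> H z.
  apply: cvgD; first by apply: cvgM; [exact: cvg_kap|exact: cvg_root_moment].
  apply: cvgMr; apply: cvg_sum_seq => b _.
  by apply: cvgM; exact: cvg_root_moment.
exact: (luc_limit_derive (ode a) dh lh (@cvg_root_moment a) cH).
Qed.

End MomentLimits.
End LargeN.

(** * Expansion of the logarithm of the modulus *)

Section LogExpansion.
Variable R : realType.
Local Notation C := (Cplx R).
Implicit Types (v z w h : C).

(** log|z|^2, the kernel of the logarithmic potential. *)
Definition lnsq z : R := ln (nc z ^+ 2).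

(** Taylor polynomial of - log (1 - v). *)
Definition log_poly (a : nat) v : C := \sum_(1 <= k < a.+1) v ^+ k / k%:R.

Lemma nc_1B_ge v : nc v <= 2^-1 -> 2^-1 <= nc (1 - v).
Proof.
have := ncD (1 - v) v; rewrite subrK nc1.
by move: (nc _) (nc _) => x y; lra.
Qed.

Lemma geo_sum (v u : C) a : u * (\sum_(1 <= k < a.+1) v ^+ k.-1) * (1 - v) = u - u * v ^+ a.
Proof.
elim: a => [|a IH]; first by rewrite big_geq// mulr0 mul0r expr0 mulr1 subrr.
rewrite big_nat_recr//=; move: (\sum_(_ <= _ < _) _) IH => S IH.
have -> : u * (S + v ^+ a) * (1 - v) = u * S * (1 - v) + u * v ^+ a * (1 - v) by ring.
by rewrite IH exprS; ring.
Qed.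

(** Along the segment t |-> t v the left-hand side has derivative - 2 Re (v (t
    v)^a / (1 - t v)), because the derivatives of the Taylor terms form a
    geometric sum. *)
Lemma log_expansion v a : nc v <= 2^-1 ->
  `|lnsq (1 - v) + 2 * re (log_poly a v)| <= 4 * nc v ^+ a.+1.
Proof.
move=> v12.
pose q (t : R) := (1 - t * re v) ^+ 2 + (t * im v) ^+ 2.
have qE t : q t = nc (1 - rc t * v) ^+ 2.
  by rewrite nc_sqr reB imB reM imM /=; rewrite /q; ring.
have tv (t : R) : 0 <= t <= 1 -> nc (rc t * v) <= nc v.
  by move=> /andP[t0 t1]; rewrite ncM nc_rc ger0_norm// ler_piMl// nc_ge0.
have n12 (t : R) : 0 <= t <= 1 -> 2^-1 <= nc (1 - rc t * v).
  by move=> t01; apply: nc_1B_ge; apply: le_trans (tv t t01) v12.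
have q0 (t : R) : 0 <= t <= 1 -> 0 < q t.
  by move=> /n12 H; rewrite qE exprn_gt0// (lt_le_trans _ H)// invr_gt0.
pose dq (t : R) := 2 * (- re v * (1 - t * re v) + im v * (t * im v)).
have Dq t : is_derive t (1 : R) q (dq t).
  have D1 : is_derive t (1 : R) (fun t => 1 - t * re v) (- re v).
    have := is_derive_fsub (is_derive_fcst 1 t) (is_derive_fmul (is_derive_fid t) (is_derive_fcst (re v) t)).
    by rewrite mulr0 mulr1 !add0r.
  have D2 : is_derive t (1 : R) (fun t => t * im v) (im v).
    have := is_derive_fmul (is_derive_fid t) (is_derive_fcst (im v) t).
    by rewrite mulr0 mulr1 add0r.
  have := is_derive_fadd (is_derive_fmul D1 D1) (is_derive_fmul D2 D2).
  set X := (X in is_derive _ _ _ X -> _); rewrite (_ : X = dq t) //.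
  by rewrite /X /dq; ring.
pose g t := ln (q t) + 2 * \sum_(1 <= k < a.+1) (re (v ^+ k) / k%:R) * t ^+ k.
pose dg t := (q t)^-1 * dq t +
  2 * \sum_(1 <= k < a.+1) (re (v ^+ k) / k%:R) * (k%:R * t ^+ k.-1).
have Dg (t : R) : 0 <= t <= 1 -> is_derive t (1 : R) g (dg t).
  move=> t01; have D1 : is_derive t (1 : R) (fun t => ln (q t)) ((q t)^-1 * dq t).
    have Hln := is_derive1_ln (q0 t t01).
    exact: (is_derive1_comp Hln (Dq t)).
  apply: (is_derive_fadd D1); apply: is_derive_fscale; apply: is_derive_fsum => k _.
  by apply: is_derive_fscale; exact: is_derive_fpow.
have g0 : g 0 = 0.
  rewrite /g qE rc0 mul0r subr0 nc1 expr1n ln1 add0r big_nat big1 ?mulr0//.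
  by move=> k /andP[k1 _]; rewrite expr0n gtn_eqF// mulr0.
have g1 : g 1 = lnsq (1 - v) + 2 * re (log_poly a v).
  rewrite /g qE rc1 mul1r /lnsq /log_poly re_sum; congr (_ + _ * _).
  apply: eq_bigr => k _; rewrite expr1n mulr1 mulrC -re_rcM rcV rc_nat.
  by rewrite [in RHS]mulrC.
have B (t : R) : 0 <= t <= 1 -> `|dg t| <= 4 * nc v ^+ a.+1.
  move=> t01; set d := 1 - rc t * v.
  have d12 : 2^-1 <= nc d by exact: n12.
  have d0 : d != 0 by rewrite -nc_gt0 (lt_le_trans _ d12)// invr_gt0.
  have E1 : (q t)^-1 * dq t = - 2 * re (v / d).
    have E : v / d * d = v by rewrite divfK.
    move: (congr1 (@re R) E) (congr1 (@im R) E); move: (v / d) => w.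
    rewrite reM imM /d reB imB [re (rc _ * _)]reM [im (rc _ * _)]imM /=.
    rewrite !mul0r subr0 addr0 => e1 e2.
    have qne0 : q t != 0 by rewrite gt_eqF// q0.
    apply: (mulfI qne0); rewrite mulVKf// /dq /q.
    (* real and imaginary part of w d = v, combined so that |d|^2 appears *)
    have aux (wr wi A B x y : R) : wr * A - wi * B = x -> wr * B + wi * A = y ->
      x * A + y * B = wr * (A ^+ 2 + B ^+ 2) by move=> <- <-; ring.
    have {aux} := aux _ _ _ _ _ _ e1 e2; rewrite ?add0r ?sub0r.
    move: (re w) (re v) (im v) => wr x y; lra.
  have E2 : \sum_(1 <= k < a.+1) (re (v ^+ k) / k%:R) * (k%:R * t ^+ k.-1) =
     re (v * \sum_(1 <= k < a.+1) (rc t * v) ^+ k.-1).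
    rewrite mulr_sumr re_sum; apply: eq_big_nat => k /andP[k1 _].
    rewrite exprMn [v * _]mulrCA -exprS prednK// -rcX re_rcM.
    by field; rewrite pnatr_eq0 -lt0n.
  have E3 : v * (\sum_(1 <= k < a.+1) (rc t * v) ^+ k.-1) - v / d = - (v * (rc t * v) ^+ a / d).
    have := geo_sum (rc t * v) v a; rewrite -/d => E.
    apply: (mulIf d0); rewrite mulrBl E mulNr !divfK//; ring.
  have -> : dg t = 2 * re (- (v * (rc t * v) ^+ a / d)).
    by rewrite -E3 reB /dg E1 E2; ring.
  rewrite normrM ger0_norm//; have -> : 4 = 2 * 2 :> R by ring.
  rewrite -[2 * 2 * _]mulrA ler_wpM2l//; apply: le_trans (re_le_nc _) _.
  rewrite ncN ncM ncV ler_pdivrMr ?(lt_le_trans _ d12) ?invr_gt0//.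
  rewrite ncM ncX exprS.
  have h1 : nc (rc t * v) ^+ a <= nc v ^+ a by rewrite lerXn2r ?nnegrE ?nc_ge0// tv.
  have h0 : 0 <= nc v ^+ a by rewrite exprn_ge0// nc_ge0.
  have := nc_ge0 v; move: h1 h0 d12.
  move: (nc (rc t * v) ^+ a) (nc d) (nc v) => X Z W; move: (W ^+ a) => Y h1 h0 d12 W0.
  have Z1 : 0 <= 2 * Z - 1 by lra.
  have : 0 <= W * Y * (2 * Z - 1) by rewrite mulr_ge0// mulr_ge0.
  have : W * X <= W * Y by rewrite ler_wpM2l.
  nra.
have := @real_mean_value R g dg (4 * nc v ^+ a.+1) 0 1.
rewrite g0 g1 !subr0 normr1 mulr1; apply.
  by move=> t; rewrite min_l// max_r// => /Dg.
by move=> t; rewrite min_l// max_r// => /B.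
Qed.

Lemma lnsqM z w : z != 0 -> w != 0 -> lnsq (z * w) = lnsq z + lnsq w.
Proof.
by move=> z0 w0; rewrite /lnsq ncM exprMn lnM// posrE exprn_gt0// nc_gt0.
Qed.

(** The case a = 1 of the expansion, with v = - h / z. *)
Lemma lnsq_shift z h : z != 0 -> nc h <= nc z / 2 ->
  `|lnsq (z + h) - lnsq z - 2 * re (h / z)| <= 4 * (nc h / nc z) ^+ 2.
Proof.
move=> z0 hz; have nz0 : 0 < nc z by rewrite nc_gt0.
pose v := - (h / z).
have nv : nc v = nc h / nc z by rewrite /v ncN ncM ncV.
have v12 : nc v <= 2^-1 by rewrite nv ler_pdivrMr// mulrC.
have v0 : 1 - v != 0.
  by rewrite -nc_gt0 (lt_le_trans _ (nc_1B_ge v12))// invr_gt0.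
have -> : z + h = z * (1 - v) by rewrite /v opprK mulrDr mulr1 mulrC divfK.
rewrite lnsqM// [lnsq z + _]addrC addrK.
have := log_expansion 1 v12; rewrite /log_poly big_nat1 expr1 divr1 nv.
by rewrite /v reN mulrN.
Qed.

End LogExpansion.

(** * Integrals against a measure carried by a disk *)

Section Potential.
Variable R : realType.
Local Notation C := (Cplx R).

Lemma open_measurableC (A : set (borelC R)) : @open C A -> measurable A.
Proof. by move=> oA; apply: sub_sigma_algebra. Qed.

(** The domination makes [f] continuous, and the sigma-algebra is generated by
    the open sets. Real part and modulus of a holomorphic function are covered
    at once. *)
Lemma measurable_of_dominated_increments (g : C -> C) (f : C -> R) :
  (forall z, derivable g z (1 : C)) ->
  (forall z w, `|f z - f w| <= nc (g z - g w)) ->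
  measurable_fun setT (f : borelC R -> R).
Proof.
move=> dg lf; apply: (measurability _ (RGenOInfty.measurableE R)) => //.
move=> /= _ [_ [x ->] <-]; rewrite setTI; apply: open_measurableC.
rewrite openE => z; rewrite /= in_itv/= andbT => xz.
have fx0 : 0 < (f z - x) / 2 by rewrite divr_gt0// subr_gt0.
have [dl dl0 H] := derivable_nc_continuous (dg z) fx0.
apply/nc_nbhsP; exists dl => // w /H; rewrite [z + (w - z)]addrC subrK nc_distC => /(le_trans (lf _ _)).
rewrite /= in_itv/= andbT ler_norml; move: (f z) (f w) xz fx0 => a b xz fx0 /andP[h1 h2].
lra.
Qed.

Lemma measurable_re (g : C -> C) : (forall z, derivable g z (1 : C)) ->
  measurable_fun setT (fun z : borelC R => re (g z)).
Proof.
move=> dg; apply: (measurable_of_dominated_increments dg) => z w.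
by rewrite -reB; exact: re_le_nc.
Qed.

Lemma measurable_nc (g : C -> C) : (forall z, derivable g z (1 : C)) ->
  measurable_fun setT (fun z : borelC R => nc (g z)).
Proof.
move=> dg; apply: (measurable_of_dominated_increments dg) => z w.
have := ncD (g z - g w) (g w); have := ncD (g w - g z) (g z).
rewrite !subrK nc_distC ler_norml.
by move: (nc _) (nc _) (nc _) => a b c h1 h2; apply/andP; split; lra.
Qed.

Lemma derivable_subl (z w : C) : derivable (fun w => z - w) w (1 : C).
Proof. exact: (@ex_derive _ _ _ _ _ _ _ (is_derive_fsub (is_derive_fcst z w) (is_derive_fid w))). Qed.

Lemma measurable_lnsq z : measurable_fun setT (fun w : borelC R => lnsq (z - w)).
Proof.
apply: measurableT_comp => //; apply: measurable_funX; exact: (measurable_nc (@derivable_subl z)).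
Qed.

Section FixedMeasure.
Variables (mu : probability (borelC R) R) (r : R).
Hypothesis r1 : 1 <= r.
Hypothesis supp : mu [set w | r < nc w] = 0%E.

Let D : set (borelC R) := [set w | nc (w : C) <= r].

Let DE : D = ~` [set w | r < nc (w : C)].
Proof. by apply/seteqP; split => w; rewrite /D /= leNgt => /negP. Qed.

Lemma measurable_far : measurable ([set w | r < nc (w : C)] : set (borelC R)).
Proof.
apply: open_measurableC; rewrite openE => z /= rz.
apply/nc_nbhsP; exists (nc z - r); first by rewrite subr_gt0.
move=> w hw; have := ncD (z - w) w; rewrite subrK nc_distC /=; move: hw.
by move: (nc (w - z)) (nc w) (nc z) rz => a b c; lra.
Qed.

Let mD : measurable D.
Proof. by rewrite DE; apply: measurableC; exact: measurable_far. Qed.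

Let muD : mu D = 1%E.
Proof. by rewrite DE probability_setC ?supp ?sube0//; exact: measurable_far. Qed.

(** Integration over the disk carrying the measure, where the integrands are
    bounded; outside it they may be unbounded or infinite. *)
Definition disk_int (f : C -> R) : R := (\int[mu]_(w in D) f w)%R.

Definition disk_bounded (f : C -> R) := measurable_fun setT (f : borelC R -> R) /\
  exists B : R, forall w, nc w <= r -> `|f w| <= B.

Lemma disk_bounded_integrable f : disk_bounded f -> mu.-integrable D (EFin \o f).
Proof.
move=> [mf [B bf]]; apply: measurable_bounded_integrable => //.
- by rewrite [X in (X < _)%E]muD ltry.
- exact: measurable_funTS.
- by exists B; split; [exact: num_real|move=> M BM w /= /bf /le_trans; apply; exact: ltW].
Qed.

Lemma disk_boundedD f g : disk_bounded f -> disk_bounded g -> disk_bounded (fun w => f w + g w).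
Proof.
move=> [mf [B bf]] [mg [B' bg]]; split; first exact: measurable_funD.
exists (B + B') => w hw; apply: le_trans (ler_normD _ _) _.
by apply: lerD; [exact: bf|exact: bg].
Qed.

Lemma disk_boundedZ c f : disk_bounded f -> disk_bounded (fun w => c * f w).
Proof.
move=> [mf [B bf]]; split; first by apply: measurable_funM.
by exists (`|c| * B) => w hw; rewrite normrM ler_wpM2l// bf.
Qed.

Lemma disk_boundedB f g : disk_bounded f -> disk_bounded g -> disk_bounded (fun w => f w - g w).
Proof.
move=> gf gg; have := disk_boundedD gf (disk_boundedZ (-1) gg).
by under [X in disk_bounded X -> _]eq_fun do rewrite mulN1r.
Qed.

Lemma disk_bounded_cst c : disk_bounded (fun=> c).
Proof. by split; [exact: measurable_cst|exists `|c|]. Qed.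

Lemma disk_intD f g : disk_bounded f -> disk_bounded g -> disk_int (fun w => f w + g w) = disk_int f + disk_int g.
Proof. by move=> *; apply: RintegralD => //; exact: disk_bounded_integrable. Qed.

Lemma disk_intB f g : disk_bounded f -> disk_bounded g -> disk_int (fun w => f w - g w) = disk_int f - disk_int g.
Proof. by move=> *; apply: RintegralB => //; exact: disk_bounded_integrable. Qed.

Lemma disk_intZ c f : disk_bounded f -> disk_int (fun w => c * f w) = c * disk_int f.
Proof. by move=> *; apply: RintegralZl => //; exact: disk_bounded_integrable. Qed.

Lemma disk_int_cst c : disk_int (fun=> c) = c.
Proof. by rewrite /disk_int Rintegral_cst// [X in fine X]muD mulr1. Qed.

Lemma disk_int_bound f B : disk_bounded f -> (forall w, nc w <= r -> `|f w| <= B) ->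
  `|disk_int f| <= B.
Proof.
move=> gf bf; have gi := disk_bounded_integrable.
rewrite ler_norml; apply/andP; split.
- rewrite -(disk_int_cst (- B)); apply: le_Rintegral => //.
  + exact: disk_bounded_integrable (disk_bounded_cst _).
  + exact: disk_bounded_integrable.
  + by move=> w /bf; rewrite ler_norml => /andP[].
- rewrite -(disk_int_cst B); apply: le_Rintegral => //.
  + exact: disk_bounded_integrable.
  + exact: disk_bounded_integrable (disk_bounded_cst _).
  + by move=> w /bf; rewrite ler_norml => /andP[].
Qed.

(** The complement of the disk is negligible. *)
Lemma integral_disk (g : borelC R -> \bar R) : measurable_fun setT g ->
  (\int[mu]_w g w = \int[mu]_(w in D) g w)%E.
Proof.
move=> mg; rewrite [RHS]integral_mkcond; apply: ae_eq_integral => //.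
  by apply/(measurable_restrictT g mD); exact: measurable_funTS.
exists [set w | r < nc (w : C)]; split => //; first exact: measurable_far.
move=> w /=.
apply: contra_notP => /negP; rewrite -leNgt => wr _.
by rewrite patchE mem_set.
Qed.

Lemma Rintegral_disk (f : C -> R) : measurable_fun setT (f : borelC R -> R) ->
  (\int[mu]_w f w)%R = disk_int f.
Proof.
by move=> mf; rewrite /disk_int /Rintegral integral_disk//; exact/measurable_EFinP.
Qed.

Lemma disk_bounded_re_poly (s : seq nat) (c : nat -> C) :
  disk_bounded (fun w => re (\sum_(k <- s) c k * w ^+ k)).
Proof.
have bnd k w : nc w <= r -> nc (c k * w ^+ k) <= nc (c k) * r ^+ k.
  move=> wr; rewrite ncM ncX ler_wpM2l ?nc_ge0// lerXn2r ?nnegrE ?nc_ge0//.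
  exact: le_trans (nc_ge0 w) wr.
split.
  apply: measurable_re => w.
  apply: (@ex_derive _ _ _ _ _ _ _ (is_derive_fsum (s := s) (fun k _ => is_derive_fscale (c k) (is_derive_fpow k w)))).
exists (\sum_(k <- s) nc (c k) * r ^+ k) => w wr.
apply: le_trans (re_le_nc _) _; apply: le_trans (nc_sum _ _ _) _.
by apply: ler_sum => k _; exact: bnd.
Qed.

Lemma disk_bounded_re_mono c k : disk_bounded (fun w => re (c * w ^+ k)).
Proof.
by have := disk_bounded_re_poly [:: k] (fun=> c); under [X in disk_bounded X -> _]eq_fun do rewrite big_seq1.
Qed.

Local Notation M := (holo_moment mu).

Lemma re_holo_moment k : re (M k) = disk_int (fun w => re (w ^+ k)).
Proof.
rewrite -Rintegral_disk//; apply: measurable_re => w.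
exact: (@ex_derive _ _ _ _ _ _ _ (is_derive_fpow k w)).
Qed.

(** The imaginary part is the real part after multiplication with - i. *)
Lemma im_holo_moment k : im (M k) = disk_int (fun w => im (w ^+ k)).
Proof.
have E : (fun w : C => im (w ^+ k)) = (fun w => re (- ('i)%C * w ^+ k)).
  by apply/funext => w; rewrite reM reN imN /=; ring.
rewrite -Rintegral_disk// E; apply: measurable_re => w.
exact: (@ex_derive _ _ _ _ _ _ _ (is_derive_fscale (- ('i)%C : C) (is_derive_fpow k w))).
Qed.

Lemma disk_int_re_mono c k : disk_int (fun w => re (c * w ^+ k)) = re (c * M k).
Proof.
have g1 : disk_bounded (fun w => re (w ^+ k)).
  by have := disk_bounded_re_mono 1 k; under [X in disk_bounded X -> _]eq_fun do rewrite mul1r.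
have E : (fun w : C => im (w ^+ k)) = (fun w => re (- ('i)%C * w ^+ k)).
  by apply/funext => w; rewrite reM reN imN /=; ring.
have g2 : disk_bounded (fun w => im (w ^+ k)) by rewrite E; exact: disk_bounded_re_mono.
rewrite reM re_holo_moment im_holo_moment -!disk_intZ// -disk_intB//; [|exact: disk_boundedZ..].
by congr disk_int; apply/funext => w; rewrite reM.
Qed.

Lemma disk_int_re_poly (s : seq nat) (c : nat -> C) :
  disk_int (fun w => re (\sum_(k <- s) c k * w ^+ k)) = re (\sum_(k <- s) c k * M k).
Proof.
elim: s => [|k s IH].
  by rewrite big_nil; under eq_fun do rewrite big_nil; exact: disk_int_cst.
rewrite big_cons reD -IH -disk_int_re_mono -disk_intD; last first.
- exact: disk_bounded_re_poly.
- exact: disk_bounded_re_mono.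
by congr disk_int; apply/funext => w; rewrite big_cons reD.
Qed.

(** For z outside the disk |z - w| stays between |z| - r and |z| + r. *)
Lemma disk_bounded_lnsq z : r < nc z -> disk_bounded (fun w => lnsq (z - w)).
Proof.
move=> rz; split; first exact: measurable_lnsq.
exists (`|ln ((nc z - r) ^+ 2)| + `|ln ((nc z + r) ^+ 2)|) => w wr.
have r0 : 0 <= r := le_trans (nc_ge0 w) wr.
have h1 : nc z - r <= nc (z - w).
  have := ncD (z - w) w; rewrite subrK; move: (nc _) (nc w) (nc z) wr => a b c; lra.
have h2 : nc (z - w) <= nc z + r by apply: le_trans (ncB _ _) _; rewrite lerD2l.
have zr0 : 0 < nc z - r by rewrite subr_gt0.
have k1 : ln ((nc z - r) ^+ 2) <= lnsq (z - w).
  rewrite /lnsq ler_ln ?posrE ?exprn_gt0 ?(lt_le_trans zr0)//.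
  by rewrite lerXn2r ?nnegrE ?nc_ge0// ltW.
have k2 : lnsq (z - w) <= ln ((nc z + r) ^+ 2).
  rewrite /lnsq ler_ln ?posrE ?exprn_gt0 ?(lt_le_trans zr0)//.
    by rewrite lerXn2r ?nnegrE ?nc_ge0// addr_ge0// nc_ge0.
  by rewrite (le_trans h1).
move: k1 k2; move: (ln _) (ln _) (lnsq _) => x y t k1 k2.
have := ler_norm x; have := ler_norm (- x); have := ler_norm y; have := ler_norm (- y).
by rewrite !normrN ler_norml => *; apply/andP; split; lra.
Qed.

Definition potential z := disk_int (fun w => lnsq (z - w)).

(** The extended logarithm only differs from the real one at w = z, which lies
    outside the disk. *)
Lemma log_potentialE z : r < nc z -> fine (log_potential mu z) = potential z.
Proof.
move=> rz; rewrite /log_potential integral_disk; last first.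
  have mn : measurable_fun setT (fun w : borelC R => nc (z - w) ^+ 2).
    by apply: measurable_funX; exact: (measurable_nc (@derivable_subl z)).
  apply: measurable_fun_ifT.
  - by apply: measurable_fun_ler => //; exact: measurable_cst.
  - exact: measurable_cst.
  - by apply/measurable_EFinP; exact: measurable_lnsq.
congr fine; apply: eq_integral => w; rewrite inE /D /= => wr.
have h : 0 < nc (z - (w : C)) ^+ 2.
  rewrite exprn_gt0// nc_gt0 subr_eq0.
  by apply: contraTneq rz => ->; rewrite -leNgt.
exact: (lne_EFin h).
Qed.

End FixedMeasure.
End Potential.

(** * The logarithmic potential near infinity *)

Section Expansions.
Variable R : realType.
Local Notation C := (Cplx R).
Variables (mu : probability (borelC R) R) (r : R).
Hypothesis r1 : 1 <= r.
Hypothesis supp : mu [set w | r < nc w] = 0%E.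
Local Notation M := (holo_moment mu).
Local Notation U := (potential mu r).

Let r0 : 0 < r. Proof. exact: lt_le_trans r1. Qed.

Let far z : 2 * r <= nc z -> [/\ 0 < nc z, z != 0 & r < nc z].
Proof. by move=> h; split; rewrite -?nc_gt0; move: h r0; move: (nc z) => x; lra. Qed.

Let ratio z w : 2 * r <= nc z -> nc w <= r -> nc (w / z) <= r / nc z /\ nc (w / z) <= 2^-1.
Proof.
move=> hz wr; have [z0 _ _] := far hz.
suff h : nc (w / z) <= r / nc z.
  split=> //; apply: le_trans h _; rewrite ler_pdivrMr//; move: hz; lra.
by rewrite ncM ncV ler_wpM2r// invr_ge0 ltW.
Qed.

(** Integrate the expansion of log|1 - w/z|^2 over the disk, where |w/z| is at
    most 1/2. *)
Lemma potential_expansion a z : 2 * r <= nc z ->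
  `|U z - lnsq z + 2 * re (\sum_(1 <= k < a.+1) z ^- k / k%:R * M k)|
    <= 4 * (r / nc z) ^+ a.+1.
Proof.
move=> hz; have [nz0 z0 rz] := far hz.
set P := fun w : C => re (\sum_(1 <= k < a.+1) z ^- k / k%:R * w ^+ k).
have gP : disk_bounded r P by exact: disk_bounded_re_poly.
have gL := disk_bounded_lnsq rz.
have -> : U z - lnsq z + 2 * re (\sum_(1 <= k < a.+1) z ^- k / k%:R * M k) =
    disk_int mu r (fun w => lnsq (z - w) - lnsq z + 2 * P w).
  rewrite disk_intD//; [|exact: disk_boundedB gL (disk_bounded_cst _ _)|exact: disk_boundedZ].
  by rewrite disk_intB//; [rewrite disk_int_cst// disk_intZ// disk_int_re_poly|exact: disk_bounded_cst].
apply: disk_int_bound => //.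
  by apply: disk_boundedD; [exact: disk_boundedB gL (disk_bounded_cst _ _)|exact: disk_boundedZ].
move=> w wr; have [h1 h2] := ratio hz wr.
have -> : z - w = z * (1 - w / z) by rewrite mulrBr mulr1 mulrC divfK.
have v0 : 1 - w / z != 0 by rewrite -nc_gt0 (lt_le_trans _ (nc_1B_ge h2))// invr_gt0.
rewrite lnsqM// [lnsq z + _]addrC addrK.
have -> : P w = re (log_poly a (w / z)).
  by rewrite /P; congr re; apply: eq_bigr => k _; rewrite expr_div_n; ring.
apply: le_trans (log_expansion a h2) _; rewrite ler_wpM2l//.
by rewrite lerXn2r ?nnegrE ?nc_ge0// divr_ge0 ?ltW.
Qed.

(** The derivative of the potential at z is h |-> 2 Re (h / (z - w))
    integrated over w. Replacing 1 / (z - w) by its geometric expansion in w /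
    z costs the first error term, the quadratic remainder of the logarithm the
    second. Both are uniform in w, so nothing has to be said on
    differentiation under the integral sign. *)
Lemma potential_shift a z h : 2 * r <= nc z -> nc h <= nc z / 4 ->
  `|U (z + h) - U z - 2 * re (h * (z^-1 * \sum_(0 <= k < a.+1) z ^- k * M k))|
    <= 4 * (r / nc z) ^+ a.+1 / nc z * nc h + 16 / nc z ^+ 2 * nc h ^+ 2.
Proof.
move=> hz hh; have [nz0 z0 rz] := far hz.
have rzh : r < nc (z + h).
  have := ncB (z + h) h; rewrite addrK; move: hh hz r0; move: (nc _) (nc h) (nc z) => x y t; lra.
set P := fun w : C => re (\sum_(0 <= k < a.+1) h * z^-1 * z ^- k * w ^+ k).
have gP : disk_bounded r P by exact: disk_bounded_re_poly.
have gL := disk_bounded_lnsq rz; have gLh := disk_bounded_lnsq rzh.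
have -> : U (z + h) - U z - 2 * re (h * (z^-1 * \sum_(0 <= k < a.+1) z ^- k * M k)) =
    disk_int mu r (fun w => lnsq (z + h - w) - lnsq (z - w) - 2 * P w).
  rewrite disk_intB//; [|exact: disk_boundedB|exact: disk_boundedZ].
  rewrite disk_intB// disk_intZ// disk_int_re_poly//; congr (_ - 2 * re _).
  by rewrite mulrA mulr_sumr; apply: eq_bigr => k _; rewrite mulrA.
apply: disk_int_bound => //; first by apply: disk_boundedB; [exact: disk_boundedB|exact: disk_boundedZ].
move=> w wr; have [h1 h2] := ratio hz wr.
have zw : nc z / 2 <= nc (z - w).
  have := ncD (z - w) w; rewrite subrK; move: hz wr; move: (nc _) (nc w) (nc z) => x y t; lra.
have zw0 : 0 < nc (z - w) by apply: lt_le_trans zw; rewrite divr_gt0.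
have zw0' : z - w != 0 by rewrite -nc_gt0.
have := lnsq_shift (z := z - w) (h := h) zw0' _; rewrite [z - w + h]addrAC.
have -> : lnsq (z + h - w) - lnsq (z - w) - 2 * P w =
   (lnsq (z + h - w) - lnsq (z - w) - 2 * re (h / (z - w))) +
   2 * re (h / (z - w) * (w / z) ^+ a.+1).
  suff -> : re (h / (z - w) * (w / z) ^+ a.+1) = re (h / (z - w)) - P w by ring.
  rewrite -reB; congr re.
  have := geo_sum (w / z) (h / z) a.+1.
  have -> : 1 - w / z = (z - w) / z by rewrite mulrBl divff.
  rewrite big_add1 /= => E.
  have -> : \sum_(0 <= k < a.+1) h * z^-1 * z ^- k * w ^+ k =
     h / z * \sum_(0 <= k < a.+1) (w / z) ^+ k.
    rewrite mulr_sumr; apply: eq_bigr => k _.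
    by rewrite expr_div_n -mulrA [z ^- k * _]mulrC.
  move: E; move: (\sum_(_ <= _ < _) _) ((w / z) ^+ a.+1) => S y E.
  apply: (@mulIf _ ((z - w) / z)); first by rewrite mulf_neq0// invr_neq0.
  rewrite [RHS]mulrBl E; field; rewrite z0; exact: zw0'.
move=> L; apply: le_trans (ler_normD _ _) _; rewrite addrC; apply: lerD.
  rewrite normrM ger0_norm//; apply: le_trans (ler_wpM2l _ (re_le_nc _)) _ => //.
  rewrite ncM ncX [nc (h / _)]ncM ncV.
  have k1 : nc (w / z) ^+ a.+1 <= (r / nc z) ^+ a.+1.
    by rewrite lerXn2r ?nnegrE ?nc_ge0// divr_ge0 ?ltW.
  have k2 : (nc (z - w))^-1 <= 2 / nc z.
    by rewrite -[2 / _]invrK lef_pV2 ?posrE ?invr_gt0 ?divr_gt0// invf_div.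
  have -> : 4 * (r / nc z) ^+ a.+1 / nc z * nc h =
     2 * (nc h * (2 / nc z) * (r / nc z) ^+ a.+1) by field; rewrite gt_eqF.
  rewrite ler_wpM2l//; apply: ler_pM => //.
  - by rewrite mulr_ge0 ?invr_ge0 ?nc_ge0.
  - by rewrite exprn_ge0 ?nc_ge0.
  - by rewrite ler_wpM2l ?nc_ge0.
apply: le_trans (L _) _.
  by move: hh zw; move: (nc _) (nc _) (nc z) => x y t; lra.
have -> : 16 / nc z ^+ 2 * nc h ^+ 2 = 4 * (nc h * (2 / nc z)) ^+ 2 by field; rewrite gt_eqF.
have k3 : nc h / nc (z - w) <= nc h * (2 / nc z).
  rewrite ler_wpM2l ?nc_ge0//.
  by rewrite -[2 / _]invrK lef_pV2 ?posrE ?invr_gt0 ?divr_gt0// invf_div.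
have k4 : 0 <= nc h / nc (z - w) by rewrite divr_ge0 ?nc_ge0.
by rewrite ler_wpM2l// lerXn2r ?nnegrE// (le_trans k4).
Qed.

End Expansions.

Section Wirtinger.
Variable R : realType.
Local Notation C := (Cplx R).

(** The quadratic error disappears in the limit t -> 0; the error linear in
    |t| persists. *)
Lemma derive_approx (g : R -> R) (x l m e K dl : R) : 0 < dl -> 0 <= K ->
  is_derive x (1 : R) g l ->
  (forall t, `|t| < dl -> `|g (x + t) - g x - t * m| <= e * `|t| + K * t ^+ 2) ->
  `|l - m| <= e.
Proof.
move=> dl0 K0 /is_deriveP dg H; apply/ler_addgt0Pr => n n0.
have n20 : 0 < n / 2 by rewrite divr_gt0.
have [d1 d10 H1] := dg _ n20.
have K1 : 0 < K + 1 by rewrite ltr_wpDl.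
(* so small that both expansions apply and K t is at most n / 2 *)
pose t := Num.min (d1 / 2) (Num.min (dl / 2) (n / 2 / (K + 1))).
have t0 : 0 < t by rewrite !lt_min !divr_gt0.
have t1 : t <= d1 / 2 by rewrite /t ge_min lexx.
have t2 : t <= dl / 2 by rewrite /t !ge_min lexx orbT.
have t3 : t * (K + 1) <= n / 2 by rewrite -ler_pdivlMr// /t !ge_min lexx !orbT.
clearbody t.
have nt : `|t| = t by rewrite ger0_norm// ltW.
have := H1 t; have := H t; rewrite nt => /(_ _) h1 /(_ _) h2.
have {}h1 := h1 ltac:(lra); have {}h2 := h2 ltac:(lra).
rewrite -(ler_pM2r t0) -{1}nt -normrM.
have -> : (l - m) * t = (g (x + t) - g x - t * m) - (g (x + t) - g x - t * l) by ring.
apply: le_trans (ler_normB _ _) _.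
by move: h1 h2 t3 t0; move: `|_| `|_| => A B; nra.
Qed.

(** Test with real h for the derivative in x and with imaginary h for the
    derivative in y; each contributes half of the error. *)
Lemma is_wirtinger_approx (f : C -> R) (z d c : C) (e K dl : R) : 0 < dl -> 0 <= K ->
  is_wirtinger f z d ->
  (forall h, nc h < dl -> `|f (z + h) - f z - 2 * re (h * c)| <= e * nc h + K * nc h ^+ 2) ->
  nc (d - c) <= e.
Proof.
move=> dl0 K0 [fx [fy [Dx Dy ->]]] H.
have hx : `|fx - 2 * re c| <= e.
  apply: (derive_approx dl0 K0 Dx) => t tdl.
  have nt : nc (rc t) = `|t| by rewrite nc_rc.
  have := H (rc t); rewrite nt => /(_ tdl); rewrite real_normK ?num_real//.
  rewrite re_rcM; have -> : z + rc t = ((complex.Re z + t) +i* complex.Im z)%C.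
    by case: (z) => a b; rewrite /rc /=; simpc.
  have -> : ((complex.Re z +i* complex.Im z)%C : C) = z by case: (z).
  by rewrite mulrCA.
have hy : `|fy - (- (2 * im c))| <= e.
  apply: (derive_approx dl0 K0 Dy) => t tdl.
  have nt : nc (rc t * ('i)%C) = `|t|.
    by rewrite ncM nc_rc [X in _ * X](_ : _ = 1) ?mulr1// /nc /= expr0n expr1n add0r sqrtr1.
  have := H (rc t * ('i)%C); rewrite nt => /(_ tdl); rewrite real_normK ?num_real//.
  rewrite -mulrA re_rcM; have -> : z + rc t * ('i)%C = (complex.Re z +i* (complex.Im z + t))%C.
    by case: (z) => a b; rewrite /rc /=; simpc.
  have -> : ((complex.Re z +i* complex.Im z)%C : C) = z by case: (z).
  have -> : re (('i)%C * c) = - im c by rewrite reM /= mul0r mul1r sub0r.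
  by rewrite !mulrN mulrCA.
apply: le_trans (nc_le_reim _) _.
have -> : re (2^-1 * (fx +i* - fy : C)%C - c) = (fx - 2 * re c) / 2.
  by rewrite reB -rc_nat -rcV re_rcM /=; field.
have -> : im (2^-1 * (fx +i* - fy : C)%C - c) = - (fy - (- (2 * im c))) / 2.
  by rewrite imB -rc_nat -rcV imM /= mul0r addr0; field.
rewrite !normrM normrN [`|2^-1|]ger0_norm//; move: hx hy.
by move: `|_| `|_| => A B; lra.
Qed.

End Wirtinger.

(** * The partial differential equation near infinity *)

Section PotentialDerivative.
Variable R : realType.
Local Notation C := (Cplx R).
Variables (mu : probability (borelC R) R) (r : R).
Hypothesis r1 : 1 <= r.
Hypothesis supp : mu [set w | r < nc w] = 0%E.
Local Notation M := (holo_moment mu).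

Lemma holo_moment0 : M 0 = 1.
Proof.
have E1 : re (M 0) = 1.
  rewrite (re_holo_moment supp) -[RHS](disk_int_cst supp).
  by congr disk_int; apply/funext => w; rewrite expr0.
have E2 : im (M 0) = 0.
  rewrite (im_holo_moment supp) -[RHS](disk_int_cst supp).
  by congr disk_int; apply/funext => w; rewrite expr0.
by move: E1 E2; case: (M 0) => x y; rewrite /re /im /= => -> ->.
Qed.

Lemma holo_moment_bound k : nc (M k) <= 2 * r ^+ k.
Proof.
have b w : nc w <= r -> nc (w ^+ k) <= r ^+ k.
  by move=> wr; rewrite ncX lerXn2r ?nnegrE ?nc_ge0// (le_trans (nc_ge0 w)).
apply: le_trans (nc_le_reim _) _; rewrite mulr_natl mulr2n; apply: lerD.
- rewrite (re_holo_moment supp); apply: (disk_int_bound supp).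
    by have := disk_bounded_re_mono r 1 k; under [X in disk_bounded _ X -> _]eq_fun do rewrite mul1r.
  by move=> w /b; apply: le_trans; exact: re_le_nc.
- rewrite (im_holo_moment supp); apply: (disk_int_bound supp).
    have -> : (fun w : C => im (w ^+ k)) = (fun w => re (- ('i)%C * w ^+ k)).
      by apply/funext => w; rewrite reM reN imN /=; ring.
    exact: disk_bounded_re_mono.
  by move=> w /b; apply: le_trans; exact: im_le_nc.
Qed.

(** z dS/dz = 1 + Q(1/z) up to order [a]; the term k = 0 is 1 because the
    measure has mass one. *)
Lemma wirtinger_expansion a z d : 2 * r <= nc z ->
  is_wirtinger (fun w => fine (log_potential mu w)) z d ->
  nc (z * d - \sum_(0 <= k < a.+1) z ^- k * M k) <= 4 * (r / nc z) ^+ a.+1.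
Proof.
move=> hz wd.
have nz0 : 0 < nc z by apply: lt_le_trans hz; rewrite mulr_gt0// (lt_le_trans _ r1).
have z0 : z != 0 by rewrite -nc_gt0.
have -> : z * d - \sum_(0 <= k < a.+1) z ^- k * M k =
    z * (d - z^-1 * \sum_(0 <= k < a.+1) z ^- k * M k).
  by rewrite mulrBr mulVKf.
rewrite ncM mulrC -ler_pdivlMr//.
apply: (@is_wirtinger_approx _ (fun w => fine (log_potential mu w)) z d _ _ (16 / nc z ^+ 2) (nc z / 4)) => //.
- by rewrite divr_gt0.
- by rewrite divr_ge0// exprn_ge0// ltW.
move=> h hh; rewrite !(log_potentialE supp); first exact: potential_shift (ltW hh).
- by move: hz r1; move: (nc z) => x; lra.
- have := ncB (z + h) h; rewrite addrK; move: hh hz r1; move: (nc _) (nc h) (nc z) => x y t; lra.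
Qed.

(** The coefficient of x^k in Q + Q^2, where Q is the generating function of
    the [m k] with k >= 1. *)
Definition moment_conv (m : nat -> C) k := m k + \sum_(1 <= b < k) m b * m (k - b)%N.

Let q (a : nat) : {poly C} := \poly_(k < a.+1) (if k == 0%N then 0 else M k).

Let coef_q a k : nc (q a)`_k <= 2 * r ^+ k.
Proof.
have rk : 0 <= 2 * r ^+ k by rewrite mulr_ge0// exprn_ge0// (le_trans _ r1).
rewrite coef_poly; case: ifP => _; last by rewrite nc0.
by case: eqP => _; [rewrite nc0|exact: holo_moment_bound].
Qed.

Let coef_q2 a k : nc (q a ^+ 2)`_k <= 4 * k.+1%:R * r ^+ k.
Proof.
rewrite expr2 coefM; apply: le_trans (nc_sum _ _ _) _.
apply: (@le_trans _ _ (\sum_(j < k.+1) 4 * r ^+ k)); last first.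
  by rewrite sumr_const card_ord -[_ *+ k.+1]mulr_natr mulrAC.
apply: ler_sum => j _; rewrite ncM.
have jk : (j <= k)%N by rewrite -ltnS.
have -> : 4 * r ^+ k = (2 * r ^+ j) * (2 * r ^+ (k - j)).
  by rewrite -{1}(subnKC jk) exprD; ring.
by apply: ler_pM; rewrite ?nc_ge0 ?coef_q.
Qed.

Let coef_q2E a k : (k <= a)%N ->
  (q a ^+ 2)`_k = \sum_(1 <= b < k) M b * M (k - b)%N.
Proof.
move=> ka; rewrite expr2 coefM -(big_mkord xpredT (fun j => (q a)`_j * (q a)`_(k - j))).
case: k ka => [|k] ka.
  by rewrite big_nat1 big_geq// coef_poly /= mul0r.
rewrite big_nat_recl// big_nat_recr//= !coef_poly /= subnn mul0r add0r mulr0 addr0.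
rewrite big_add1 /=; apply: eq_big_nat => j /andP[_ jk].
have h1 : (j.+1 < a.+1)%N by lia.
have h2 : (k.+1 - j.+1 < a.+1)%N by lia.
have h3 : (k.+1 - j.+1 == 0)%N = false by apply/negbTE; lia.
by rewrite !coef_poly h1 h2 h3.
Qed.

Let s z := r / nc z.

(** The square of the truncated generating function produces the convolutions
    up to degree [a]; the remaining coefficients grow like k r^k, and r / |z|
    is at most 1, so they are absorbed by the error term. *)
Lemma quadratic_expansion a z : 2 * r <= nc z ->
  forall T, T = \sum_(0 <= k < a.+1) z ^- k * M k ->
  nc (T ^+ 2 - T - \sum_(1 <= k < a.+1) z ^- k * moment_conv M k)
    <= (\sum_(i < a.+1) 4 * (a.+1 + i).+1%:R) * s z ^+ a.+1.
Proof.
move=> hz T defT.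
have nz0 : 0 < nc z by apply: lt_le_trans hz; rewrite mulr_gt0// (lt_le_trans _ r1).
have r0 : 0 <= r by rewrite (le_trans _ r1).
have s01 : 0 <= s z <= 1.
  by rewrite /s divr_ge0 ?(ltW nz0)//= ler_pdivrMr//; move: hz r0; lra.
have /andP[s0 s1] := s01.
pose x := z^-1.
have zk k : z ^- k = x ^+ k by rewrite exprVn.
have qx : (q a).[x] = \sum_(1 <= k < a.+1) z ^- k * M k.
  rewrite (horner_coef_wide _ (size_poly _ _)) big_add1 /=.
  rewrite big_ord_recl coef_poly /= mul0r add0r big_mkord; apply: eq_bigr => k _.
  by rewrite coef_poly /bump /= add1n ltnS ltn_ord zk mulrC.
have TE : T = 1 + (q a).[x].
  by rewrite defT big_nat_recl// expr0 invr1 mul1r holo_moment0 qx big_add1.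
have sq : (size (q a ^+ 2) <= a.+1 + a.+1)%N.
  rewrite expr2; apply: leq_trans (size_polyMleq _ _) _.
  apply: leq_trans (leq_pred _) _; apply: leq_add; exact: size_poly.
have q2x : (q a).[x] ^+ 2 = \sum_(1 <= k < a.+1) z ^- k * (\sum_(1 <= b < k) M b * M (k - b)%N)
     + \sum_(i < a.+1) (q a ^+ 2)`_(a.+1 + i) * x ^+ (a.+1 + i).
  rewrite -horner_exp (horner_coef_wide _ sq) big_split_ord /=; congr (_ + _).
  have q20 : (q a ^+ 2)`_0 = 0 by rewrite coef_q2E// big_geq.
  rewrite big_ord_recl /= q20 mul0r add0r big_add1 /= big_mkord.
  by apply: eq_bigr => k _; rewrite /bump /= add1n coef_q2E// zk mulrC.
have -> : T ^+ 2 - T - \sum_(1 <= k < a.+1) z ^- k * moment_conv M k =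
   \sum_(i < a.+1) (q a ^+ 2)`_(a.+1 + i) * x ^+ (a.+1 + i).
  under eq_bigr do rewrite /moment_conv mulrDr.
  rewrite big_split /= -qx TE.
  have -> : (1 + (q a).[x]) ^+ 2 - (1 + (q a).[x]) = (q a).[x] + (q a).[x] ^+ 2 by ring.
  by rewrite q2x; ring.
apply: le_trans (nc_sum _ _ _) _; rewrite mulr_suml; apply: ler_sum => i _.
rewrite ncM ncX ncV; apply: le_trans (ler_wpM2r _ (coef_q2 _ _)) _.
  by rewrite exprn_ge0// invr_ge0 ltW.
have -> : 4 * (a.+1 + i).+1%:R * r ^+ (a.+1 + i) * (nc z)^-1 ^+ (a.+1 + i) =
  4 * (a.+1 + i).+1%:R * s z ^+ (a.+1 + i) by rewrite -mulrA -exprMn.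
rewrite ler_wpM2l ?mulr_ge0//.
by rewrite exprD ler_piMr ?exprn_ge0// exprn_ile1.
Qed.

(** Depends on [a] only: what matters is that the error term below is uniform
    over all measures carried by the disk of radius [r]. *)
Definition pde_const (a : nat) : R :=
  8 * a.+1%:R + 6 + \sum_(i < a.+1) 4 * (a.+1 + i).+1%:R.

(** The right-hand side of the partial differential equation is - (T^2 - T) /
    2 with T = z dS/dz, and T is known up to an error of order a + 1. *)
Lemma pde_expansion a z d : 2 * r <= nc z ->
  is_wirtinger (fun w => fine (log_potential mu w)) z d ->
  nc (- 2^-1 * (z ^+ 2 * d ^+ 2 - z * d) +
      2^-1 * \sum_(1 <= k < a.+1) z ^- k * moment_conv M k)
    <= pde_const a * s z ^+ a.+1.
Proof.
move=> hz wd; have := wirtinger_expansion a hz wd.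
set T := \sum_(0 <= k < a.+1) _; have := quadratic_expansion hz (erefl T).
set H := \sum_(1 <= k < a.+1) _.
set Kq := \sum_(i < a.+1) _; move=> h2 h1.
have nz0 : 0 < nc z by apply: lt_le_trans hz; rewrite mulr_gt0// (lt_le_trans _ r1).
have r0 : 0 <= r by rewrite (le_trans _ r1).
have s0 : 0 <= s z by rewrite /s divr_ge0 ?(ltW nz0).
have s12 : s z <= 2^-1 by rewrite /s ler_pdivrMr//; move: hz r0; lra.
have s1 : s z <= 1 by move: s12; lra.
have Tb : nc T <= 2 * a.+1%:R.
  apply: le_trans (nc_sum _ _ _) _; rewrite big_mkord.
  apply: (@le_trans _ _ (\sum_(i < a.+1) 2)); last by rewrite sumr_const card_ord mulr_natr.
  apply: ler_sum => i _; rewrite ncM ncV ncX mulrC.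
  rewrite ler_pdivrMr ?exprn_gt0//; apply: le_trans (holo_moment_bound _) _.
  rewrite ler_wpM2l// lerXn2r ?nnegrE//; first exact: ltW.
  by move: hz r0; lra.
set ep := z * d - T in h1.
have -> : - 2^-1 * (z ^+ 2 * d ^+ 2 - z * d) + 2^-1 * H =
    - 2^-1 * ((T ^+ 2 - T - H) + ep * (2 * T - 1 + ep)) by rewrite /ep; ring.
rewrite ncM ncN ncV nc_nat; set y := s z ^+ a.+1 in h1 h2 *.
have y0 : 0 <= y by rewrite exprn_ge0.
have y1 : y <= 2^-1.
  by rewrite /y exprS; apply: le_trans s12; rewrite ler_piMr// exprn_ile1.
have h3 : nc (2 * T - 1 + ep) <= 4 * a.+1%:R + 3.
  apply: le_trans (ncD _ _) _; have := ncB (2 * T) 1; rewrite ncM nc_nat nc1.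
  by move: h1 Tb y1; move: (nc _) (nc T) (nc _) => A B D; lra.
rewrite /pde_const -/Kq mulrC ler_pdivrMr//.
apply: le_trans (ncD _ _) _.
have h4 : nc (ep * (2 * T - 1 + ep)) <= 4 * y * (4 * a.+1%:R + 3).
  by rewrite ncM; apply: ler_pM; rewrite ?nc_ge0.
have Kq0 : 0 <= Kq by apply: sumr_ge0 => i _; rewrite mulr_ge0.
have : 0 <= Kq * y by rewrite mulr_ge0.
move: h2 h4; move: (nc _) (nc _) (a.+1%:R) => A B N; nra.
Qed.

End PotentialDerivative.

Section WirtingerCalculus.
Variable R : realType.
Local Notation C := (Cplx R).

Lemma is_wirtinger_add_re (f : C -> R) (m : C -> C) (z d g : C) :
  is_wirtinger f z d -> is_derive z (1 : C) m g ->
  is_wirtinger (fun t => f t + 2 * re (m t)) z (d + g).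
Proof.
move=> [fx [fy [Dx Dy ->]]] Dm.
have zE : z = (complex.Re z +i* complex.Im z)%C by case: (z).
have hx : is_derive (complex.Re z) (1 : R)
    (fun x : R => re (m (x +i* complex.Im z)%C)) (re g).
  have E x : (x +i* complex.Im z)%C = (0 +i* complex.Im z)%C + rc x * 1 :> C.
    by rewrite /rc; simpc.
  under eq_fun do rewrite E.
  have := @is_derive_line _ m (0 +i* complex.Im z)%C 1 g (complex.Re z).
  by rewrite -E -zE mul1r => /(_ Dm)[].
have hy : is_derive (complex.Im z) (1 : R)
    (fun y : R => re (m (complex.Re z +i* y)%C)) (- im g).
  have E y : (complex.Re z +i* y)%C = (complex.Re z +i* 0)%C + rc y * ('i)%C :> C.
    by rewrite /rc; simpc.
  under eq_fun do rewrite E.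
  have := @is_derive_line _ m (complex.Re z +i* 0)%C ('i)%C g (complex.Im z).
  by rewrite -E -zE reM /= mul0r mul1r sub0r => /(_ Dm)[].
exists (fx + 2 * re g), (fy + 2 * (- im g)); split.
- exact: is_derive_fadd Dx (is_derive_fscale 2 hx).
- exact: is_derive_fadd Dy (is_derive_fscale 2 hy).
- have -> : ((fx + 2 * re g) +i* - (fy + 2 * - im g))%C = (fx +i* - fy)%C + 2 * g :> C.
    by case: (g) => u v; rewrite -rc_nat /rc /re /im /=; simpc; congr (_ +i* _)%C; ring.
  by rewrite mulrDr mulKf// pnatr_eq0.
Qed.

(** Only partial derivatives exist, so the path goes from z0 horizontally and
    then vertically to z; on it the distance to z0 never exceeds that of the
    endpoint. *)
Lemma wirtinger_mean_value (g : C -> R) (z0 z c : C) (E : R) :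
  (forall w, nc (w - z0) <= nc (z - z0) ->
     exists2 D, is_wirtinger g w D & nc (D - c) <= E) ->
  `|g z - g z0 - 2 * re ((z - z0) * c)| <= 4 * E * nc (z - z0).
Proof.
case: z0 z => x0 y0 [x1 y1]; set z0 : C := (x0 +i* y0)%C; set z : C := (x1 +i* y1)%C.
move=> HD.
have zz : z - z0 = ((x1 - x0) +i* (y1 - y0))%C by rewrite /z /z0; simpc.
have parts w : nc (w - z0) <= nc (z - z0) -> exists fx fy : R,
   [/\ is_derive (complex.Re w) (1 : R) (fun x : R => g (x +i* complex.Im w)%C) fx,
       is_derive (complex.Im w) (1 : R) (fun y : R => g (complex.Re w +i* y)%C) fy,
       `|fx - 2 * re c| <= 2 * E & `|fy + 2 * im c| <= 2 * E].
  move=> hw; have [D [fx [fy [Dx Dy ED]]] H] := HD w hw.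
  exists fx, fy; split => //.
  - have := re_le_nc (D - c); rewrite reB.
    rewrite [re D](_ : _ = 2^-1 * fx); last by rewrite ED -rc_nat -rcV re_rcM.
    have -> : 2^-1 * fx - re c = (fx - 2 * re c) / 2 by field.
    by rewrite normrM [`|2^-1|]ger0_norm//; move: H; move: `|_| (nc _) => A B; lra.
  - have := im_le_nc (D - c); rewrite imB.
    rewrite [im D](_ : _ = 2^-1 * - fy); last first.
      by rewrite ED -rc_nat -rcV imM /= mul0r addr0.
    have -> : 2^-1 * - fy - im c = - (fy + 2 * im c) / 2 by field.
    by rewrite normrM normrN [`|2^-1|]ger0_norm//; move: H; move: `|_| (nc _) => A B; lra.
have sqle (u v : C) : re u ^+ 2 <= re v ^+ 2 -> im u ^+ 2 <= im v ^+ 2 -> nc u <= nc v.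
  move=> h1 h2; rewrite -(@ler_pXn2r _ 2) ?nnegrE ?nc_ge0//.
  by rewrite !nc_sqr lerD.
have between (a b t : R) : Num.min a b <= t <= Num.max a b -> (t - a) ^+ 2 <= (b - a) ^+ 2.
  case: (leP a b) => ab /andP[h1 h2]; nra.
pose dx := 'D_1 (fun x : R => g (x +i* y0)%C).
have hdx x : Num.min x0 x1 <= x <= Num.max x0 x1 ->
   is_derive x (1 : R) (fun x : R => g (x +i* y0)%C) (dx x) /\ `|dx x - 2 * re c| <= 2 * E.
  move=> /between hx; have [|fx [fy [Dx _ Ex _]]] := parts (x +i* y0)%C.
    by apply: sqle; rewrite zz /z0 /re /im /= ?subrr ?expr0n ?sqr_ge0.
  have Dx' : is_derive x (1 : R) (fun x : R => g (x +i* y0)%C) fx by exact: Dx.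
  by rewrite /dx (@derive_val _ _ _ _ _ _ _ Dx').
pose dy := 'D_1 (fun y : R => g (x1 +i* y)%C).
have hdy y : Num.min y0 y1 <= y <= Num.max y0 y1 ->
   is_derive y (1 : R) (fun y : R => g (x1 +i* y)%C) (dy y) /\ `|dy y + 2 * im c| <= 2 * E.
  move=> /between hy; have [|fx [fy [_ Dy _ Ey]]] := parts (x1 +i* y)%C.
    by apply: sqle; rewrite zz /z0 /re /im /=.
  have Dy' : is_derive y (1 : R) (fun y : R => g (x1 +i* y)%C) fy by exact: Dy.
  by rewrite /dy (@derive_val _ _ _ _ _ _ _ Dy').
have H1 := @real_mean_value R (fun x => g (x +i* y0)%C - 2 * re c * x) (fun x => dx x - 2 * re c * 1)
   (2 * E) x0 x1 (fun x hx => is_derive_fsub (hdx x hx).1 (is_derive_fscale (2 * re c) (is_derive_fid x))).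
have H2 := @real_mean_value R (fun y => g (x1 +i* y)%C + 2 * im c * y) (fun y => dy y + 2 * im c * 1)
   (2 * E) y0 y1 (fun y hy => is_derive_fadd (hdy y hy).1 (is_derive_fscale (2 * im c) (is_derive_fid y))).
have {}H1 := H1 (fun x hx => ltac:(rewrite mulr1; exact: (hdx x hx).2)).
have {}H2 := H2 (fun x hx => ltac:(rewrite mulr1; exact: (hdy x hx).2)).
have -> : g z - g z0 - 2 * re ((z - z0) * c) =
    (g z + 2 * im c * y1 - (g (x1 +i* y0)%C + 2 * im c * y0)) +
    (g (x1 +i* y0)%C - 2 * re c * x1 - (g z0 - 2 * re c * x0)).
  by rewrite zz reM /=; ring.
apply: le_trans (ler_normD _ _) _; apply: le_trans (lerD H2 H1) _.
have E0 : 0 <= E.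
  by have [D _] := HD z (lexx _); apply: le_trans; exact: nc_ge0.
have n1 : `|x1 - x0| <= nc (z - z0) by rewrite zz; exact: (re_le_nc (_ +i* _)%C).
have n2 : `|y1 - y0| <= nc (z - z0) by rewrite zz; exact: (im_le_nc (_ +i* _)%C).
move: n1 n2; move: `|_| `|_| (nc _) => A B N; nra.
Qed.

(** Take z on the ray of an a-th root of X. *)
Lemma align_power (a : nat) (X : C) (m : R) : (0 < a)%N -> X != 0 -> 0 < m ->
  exists2 z : C, nc z = m & re (z ^- a * X) = nc X / m ^+ a.
Proof.
move=> a0 X0 m0; pose Y : C := a.-root X.
have YX : Y ^+ a = X by exact: rootCK.
have Y0 : 0 < nc Y.
  by rewrite nc_gt0; apply: contraNneq X0 => Y0; rewrite -YX Y0 expr0n gtn_eqF.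
exists (rc (m / nc Y) * Y).
  by rewrite ncM nc_rc ger0_norm ?divr_ge0 ?ltW// divfK// gt_eqF.
rewrite exprMn YX invfM -mulrA mulVf// mulr1 -rcX -rcV re_rc.
by rewrite expr_div_n invf_div -ncX YX.
Qed.

End WirtingerCalculus.

(** * Evolution of the holomorphic moments *)

Section HolomorphicMoments.
Variable R : realType.
Local Notation C := (Cplx R).
Variables (U : set C) (mu : C -> probability (borelC R) R).
Hypotheses (oU : open U) (pdeU : pde_near_infinity mu U).

Let M a t : C := holo_moment (mu t) a.
Let A a t : C := moment_conv (M^~ t) a.

(** What the hypothesis on the family provides at one parameter value. *)
Definition controlled (r : R) t := [/\ U t, mu t [set w | r < nc w] = 0%E &
  forall z, r < nc z -> log_potential_pde mu z t].

(** The radius is enlarged to at least 1: the hypothesis on the family allows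
    any real number, the expansions need a positive one. *)
Lemma controlled_near t0 : U t0 -> exists r : R, 1 <= r /\
  exists2 dl : R, 0 < dl & forall t, nc (t - t0) < dl -> controlled r t.
Proof.
move=> Ut0; have [r0 H] := pdeU Ut0.
have nU : nbhs t0 U by apply: open_nbhs_nbhs.
have [dl dl0 K] := (nc_nbhsP _ _).1 (filterI nU H).
exists (Num.max r0 1); split; first by rewrite le_max lexx orbT.
exists dl => // t /K[Ut [s0 pde]]; split => //.
- apply/eqP; rewrite eq_le measure_ge0 andbT -s0.
  apply: le_measure; rewrite ?inE; [exact: measurable_far..|].
  by move=> w /=; apply: le_lt_trans; rewrite le_max lexx.
- by move=> z hz; apply: pde; apply: le_lt_trans hz; rewrite le_max lexx.
Qed.

Section Ball.
Variables (r dl : R) (t0 : C) (a : nat).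
Hypotheses (r1 : 1 <= r) (ball : forall t, nc (t - t0) < dl -> controlled r t).
Hypothesis a0 : (0 < a)%N.
Hypothesis lower : forall k, (k < a)%N -> forall t, U t ->
  is_derive t (1 : C) (M k) (k%:R / 2 * A k t).

(** Fix z and let F be S(z,.) without the contributions of the moments of
    order k < a, which are differentiable by induction. The partial
    differential equation says that F has Wirtinger derivative - A_a z^-a / 2
    up to order z^-(a+1), while F = log|z|^2 - 2 Re (M_a z^-a) / a up to the
    same order. If A_a is within e of c on the ball, the mean value inequality
    for F bounds Re (X z^-a), where X is the error in the claim, and |z| ->
    infinity removes the remainders. *)
Lemma moment_increment (c t : C) (e : R) : nc (t - t0) < dl ->
  (forall u, nc (u - t0) <= nc (t - t0) -> nc (A a u - c) <= e) ->
  nc (M a t - M a t0 - (t - t0) * (a%:R / 2 * c)) <= a%:R * e * nc (t - t0).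
Proof.
move=> tdl He; set d := nc (t - t0); set X := (X in nc X).
have aC : a%:R != 0 :> C by rewrite pnatr_eq0 -lt0n.
have aR : 0 < a%:R :> R by rewrite ltr0n.
have e0 : 0 <= e by apply: le_trans (nc_ge0 _) (He t (lexx _)).
have d0 : 0 <= d by exact: nc_ge0.
have r0 : 0 < r by exact: lt_le_trans r1.
have [X0|X0] := eqVneq X 0; first by rewrite X0 nc0 !mulr_ge0.
pose B := (8 + 4 * pde_const R a * d) * r ^+ a.+1.
suff main m : 2 * r <= m -> 2 / a%:R * nc X <= B / m + 2 * e * d.
  have -> : a%:R * e * d = a%:R / 2 * (2 * e * d) by field.
  rewrite -ler_pdivrMl ?divr_gt0// invf_div.
  apply/ler_addgt0Pr => n n0.
  (* the radius |z| at which the remainder B / m drops below n *)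
  pose m := Num.max (2 * r) (`|B| / n).
  have m1 : 2 * r <= m by rewrite le_max lexx.
  have m0 : 0 < m by apply: lt_le_trans m1; rewrite mulr_gt0.
  apply: le_trans (main m m1) _; rewrite addrC lerD2l ler_pdivrMr//.
  have : `|B| / n <= m by rewrite le_max lexx orbT.
  by rewrite ler_pdivrMr// mulrC; apply: le_trans; exact: ler_norm.
move=> hm; have m0 : 0 < m by apply: lt_le_trans hm; rewrite mulr_gt0.
(* in this direction Re (X z^-a) is |X| / m^a *)
have [z zm zX] := align_power a0 X0 m0.
have hz : 2 * r <= nc z by rewrite zm.
have rz : r < nc z by apply: lt_le_trans hz; move: r0; lra.
pose S u := fine (log_potential (mu u) z).
pose lo u := \sum_(1 <= k < a) z ^- k / k%:R * M k u.
pose F u := S u + 2 * re (lo u).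
pose s := r / m.
have inb u : nc (u - t0) <= d -> nc (u - t0) < dl by move=> h; exact: le_lt_trans h tdl.
have FE u : nc (u - t0) <= d ->
    `|F u - lnsq z + 2 * re (z ^- a / a%:R * M a u)| <= 4 * s ^+ a.+1.
  move=> hu; have [_ su _] := ball (inb u hu).
  have := potential_expansion r1 su a hz; rewrite big_nat_recr//= reD zm -/s.
  rewrite -(log_potentialE su)// -/(S u) -/(lo u) /F.
  by congr (`|_| <= _); ring.
(* the Wirtinger derivative of F predicted by c, and the error of this
   prediction *)
pose c' := - 2^-1 * (z ^- a * c).
pose E := pde_const R a * s ^+ a.+1 + 2^-1 * e / m ^+ a.
have DF u : nc (u - t0) <= nc (t - t0) ->
    exists2 D, is_wirtinger F u D & nc (D - c') <= E.
  move=> hu; have [Uu su pde] := ball (inb u hu).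
  have [St [Sz [wt wz StE]]] := pde z rz.
  have Dlo : is_derive u (1 : C) lo
      (\sum_(1 <= k < a) z ^- k / k%:R * (k%:R / 2 * A k u)).
    apply: is_derive_fsum => k; rewrite mem_index_iota => /andP[_ ka].
    by apply: is_derive_fscale; exact: lower.
  exists (St + \sum_(1 <= k < a) z ^- k / k%:R * (k%:R / 2 * A k u)).
    exact: is_wirtinger_add_re wt Dlo.
  have -> : \sum_(1 <= k < a) z ^- k / k%:R * (k%:R / 2 * A k u) =
      2^-1 * \sum_(1 <= k < a) z ^- k * A k u.
    rewrite mulr_sumr; apply: eq_big_nat => k /andP[k1 _].
    have kC : k%:R != 0 :> C by rewrite pnatr_eq0 -lt0n.
    by move: (z ^- k) => y; field.
  have := pde_expansion r1 su a hz wz; rewrite -StE big_nat_recr//= zm -/s => P.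
  have -> : St + 2^-1 * (\sum_(1 <= k < a) z ^- k * A k u) - c' =
     (St + 2^-1 * (\sum_(1 <= k < a) z ^- k * A k u + z ^- a * A a u)) -
     2^-1 * (z ^- a * (A a u - c)) by rewrite /c'; ring.
  apply: le_trans (ncB _ _) _; apply: lerD; first exact: P.
  rewrite !ncM !ncV nc_nat ncX zm -mulrA ler_wpM2l ?invr_ge0// mulrC.
  by rewrite ler_wpM2r ?invr_ge0 ?exprn_ge0 ?(ltW m0)// He.
have P := wirtinger_mean_value DF.
have P1 := FE t (lexx _).
have P0 : `|F t0 - lnsq z + 2 * re (z ^- a / a%:R * M a t0)| <= 4 * s ^+ a.+1.
  by apply: FE; rewrite subrr nc0.
have XE : 2 / a%:R * (nc X / m ^+ a) = 2 * re (z ^- a / a%:R * M a t) -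
    2 * re (z ^- a / a%:R * M a t0) + 2 * re ((t - t0) * c').
  rewrite -zX; have -> : 2 / a%:R * re (z ^- a * X) = 2 * re (a%:R^-1 * (z ^- a * X)).
    have aE : (a%:R : C)^-1 = rc (a%:R^-1) by rewrite rcV rc_nat.
    by rewrite aE re_rcM mulrA.
  rewrite -mulrBr -mulrDr -reB -reD; congr (2 * re _).
  by rewrite /X /c'; move: (z ^- a) => y; field.
have main : 2 / a%:R * (nc X / m ^+ a) <= 8 * s ^+ a.+1 + 4 * E * d.
  rewrite XE; move: P P1 P0; rewrite -/d !ler_norml => /andP[p1 p2] /andP[p3 p4] /andP[p5 p6].
  move: p1 p2 p3 p4 p5 p6; move: (s ^+ _) (E * d) => y; rewrite -[4 * E * d]mulrA.
  move: (E * d) => w _; lra.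
have ma0 : 0 < m ^+ a by rewrite exprn_gt0.
have -> : B / m + 2 * e * d = (8 * s ^+ a.+1 + 4 * E * d) * m ^+ a.
  rewrite /E /B /s expr_div_n [m ^+ a.+1]exprS.
  by move: ma0; move: (m ^+ a) => y y0; field; rewrite !gt_eqF.
by rewrite -ler_pdivrMr// -[_ / m ^+ a]mulrA.
Qed.

(** The comparison value c = 0 is enough here: moments of measures carried by
    a fixed disk are bounded. *)
Lemma moment_lipschitz : 0 < dl ->
  exists L : R, forall t, nc (t - t0) < dl -> nc (M a t - M a t0) <= L * nc (t - t0).
Proof.
move=> dl0.
pose e := 2 * r ^+ a + \sum_(1 <= b < a) (2 * r ^+ b) * (2 * r ^+ (a - b)).
exists (a%:R * e) => t tdl.
have := @moment_increment 0 t e tdl; rewrite !mulr0 subr0; apply=> u hu.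
have [_ su _] := ball (le_lt_trans hu tdl).
rewrite subr0 /A /moment_conv; apply: le_trans (ncD _ _) _; apply: lerD.
  exact: (holo_moment_bound su).
apply: le_trans (nc_sum _ _ _) _; apply: ler_sum => b _.
by rewrite ncM; apply: ler_pM; rewrite ?nc_ge0//; exact: (holo_moment_bound su).
Qed.

End Ball.

(** By induction the lower moments are continuous and M_a is Lipschitz, so A_a
    is continuous; hence c = A_a(t) may be used with e arbitrarily small near
    t. *)
Lemma holo_moment_ode a t : U t -> is_derive t (1 : C) (M a) (a%:R / 2 * A a t).
Proof.
elim/ltn_ind: a t => a IH t0 Ut0.
have [r [r1 [dl dl0 ball]]] := controlled_near Ut0.
have [a0|a0] := posnP a.
  apply/is_derive_ncP => e e0; exists dl => // h hh.
  have st := holo_moment0; rewrite a0 !mul0r mulr0 subr0.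
  have [_ s0 _] : controlled r t0 by apply: ball; rewrite subrr nc0.
  have [_ s1 _] : controlled r (t0 + h) by apply: ball; rewrite addrC addKr.
  by rewrite /M (holo_moment0 s0) (holo_moment0 s1) subrr nc0 mulr_ge0 ?nc_ge0 ?ltW.
have [L HL] := moment_lipschitz r1 ball a0 IH dl0.
have cM b : (b <= a)%N -> M b @ t0 --> M b t0.
  rewrite leq_eqVlt => /predU1P[->|ba]; apply/continuous_at_ncP => e e0.
    have L1 : 0 < `|L| + 1 by rewrite ltr_wpDl.
    exists (Num.min dl (e / (`|L| + 1))); first by rewrite lt_min dl0 divr_gt0.
    move=> w; rewrite lt_min => /andP[/HL h1]; rewrite ltr_pdivlMr// => h2.
    apply: le_trans h1 _; have := ler_norm L; have := nc_ge0 (w - t0).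
    by move: h2; move: (nc _) => x; nra.
  have Mb := @ex_derive _ _ _ _ _ _ _ (IH b ba t0 Ut0).
  have [d d0 Hd] := derivable_nc_continuous Mb e0.
  by exists d => // w /Hd; rewrite [t0 + _]addrC subrK.
have cS : (fun t => \sum_(1 <= b < a) M b t * M (a - b)%N t) @ t0 -->
    \sum_(1 <= b < a) M b t0 * M (a - b)%N t0.
  apply: (@cvg_sum_seq _ _ (nbhs t0) (nbhs_filter t0)) => b.
  rewrite mem_index_iota => /andP[b1 ba].
  exact: (@cvgM _ _ (nbhs t0) (nbhs_filter t0) _ _ _ _
    (cM b (ltnW ba)) (cM (a - b)%N (leq_subr b a))).
have cA : A a @ t0 --> A a t0.
  exact: (@cvgD _ _ _ (nbhs t0) (nbhs_filter t0) _ _ _ _ (cM a (leqnn a)) cS).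
apply/is_derive_ncP => e e0.
have aR : 0 < a%:R :> R by rewrite ltr0n.
have [|d d0 Hd] := (continuous_at_ncP _ _).1 cA (e / a%:R); first by rewrite divr_gt0.
exists (Num.min dl d); first by rewrite lt_min dl0.
move=> h; rewrite lt_min => /andP[h1 h2].
have thE : t0 + h - t0 = h by rewrite addrC addKr.
have := @moment_increment r dl t0 a r1 ball a0 IH (A a t0) (t0 + h) (e / a%:R).
rewrite thE [a%:R * (e / _)]mulrC divfK ?gt_eqF//; apply=> // u hu.
by apply: Hd; exact: le_lt_trans h2.
Qed.

End HolomorphicMoments.

Theorem theorem6p11 (R : realType) :
  (forall (N : nat) (p : {poly Cplx R}),
     (0 < N)%N -> size p = N.+1 ->
     forall tau : Cplx R,
     [/\ is_derive tau (1 : Cplx R) (root_moment N p 0) (0 : Cplx R),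
         is_derive tau (1 : Cplx R) (root_moment N p 1)
           (2^-1 * root_moment N p 1 tau)
       & forall a : nat, (2 <= a)%N ->
         is_derive tau (1 : Cplx R) (root_moment N p a)
           (a%:R / 2 * root_moment N p a tau
            + a%:R / 2 * (\sum_(1 <= b < a)
                root_moment N p b tau * root_moment N p (a - b) tau)
            - a%:R * (a%:R - 1) / (2 * N%:R) * root_moment N p a tau)]) /\
  (forall p : nat -> {poly Cplx R},
     (forall N : nat, (0 < N)%N -> size (p N) = N.+1) ->
     (forall a : nat, cvgn (fun N : nat => root_moment N (p N) a 0)) ->
     (forall (a : nat) (tau : Cplx R),
        cvgn (fun N : nat => root_moment N (p N) a tau)) /\
     let M (a : nat) (tau : Cplx R) : Cplx R :=
       limn (fun N : nat => root_moment N (p N) a tau) in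
     forall (a : nat) (tau : Cplx R),
       is_derive tau (1 : Cplx R) (M a)
         (a%:R / 2 * M a tau
          + a%:R / 2 * (\sum_(1 <= b < a) M b tau * M (a - b)%N tau))) /\
  (forall (U : set (Cplx R)) (mu : Cplx R -> probability (borelC R) R),
     open U ->
     (forall tau : Cplx R, U tau -> compactly_supported (mu tau)) ->
     pde_near_infinity mu U ->
     let M (a : nat) (tau : Cplx R) : Cplx R := holo_moment (mu tau) a in
     forall (a : nat) (tau : Cplx R), U tau ->
       is_derive tau (1 : Cplx R) (M a)
         (a%:R / 2 * M a tau
          + a%:R / 2 * (\sum_(1 <= b < a) M b tau * M (a - b)%N tau))).

Proof.
split; [|split].
- move=> N p N0 sp tau; have ode := root_moment_ode (fun _ => sp); split.
  + by have := ode 0%N tau; rewrite !mul0r addr0 subr0.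
  + have := ode 1%N tau; rewrite big_geq// subrr !mulr0 mul0r addr0 mul0r subr0.
    by rewrite mul1r.
  + by move=> a _; exact: ode.
- move=> p sp cp; split.
    by move=> a tau; exact: cvgP (cvg_root_moment sp cp (a:=a) (tau:=tau)).
  by move=> M a tau; exact: limit_moment_ode.
- move=> U mu oU _ pdeU M a tau Utau.
  by rewrite -mulrDr; exact: (holo_moment_ode oU pdeU a Utau).
Qed.
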